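(* The $f$-vector $(20,40,28,8)$ is not inscribable; that is, no convex $4$-polytope with $20$ vertices, $40$ edges, $28$ two-dimensional faces and $8$ facets is inscribable.
   Context: The $f$-vector of a $d$-polytope $P$ is $(f_0,f_1,\dots,f_{d-1})$, where $f_i$ is the number of $i$-dimensional faces of $P$. A $d$-polytope is inscribed if all its vertices lie on a common $(d-1)$-sphere in $\mathbb{R}^d$, and it is inscribable if it is combinatorially equivalent (isomorphic face lattice) to an inscribed polytope. An $f$-vector is inscribable if at least one polytope with that $f$-vector is inscribable. *)

(* Defs.v *)
From mathcomp Require Import all_boot all_order all_algebra.
From mathcomp Require Import boolp classical_sets functions cardinality.
From mathcomp Require Import reals convex.

Set Implicit Arguments.
Unset Strict Implicit.
Unset Printing Implicit Defensive.

Import Order.TTheory GRing.Theory Num.Theory.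

Local Open Scope classical_set_scope.
Local Open Scope card_scope.
Local Open Scope ring_scope.

Definition dot (R : realType) (n : nat) (u v : 'rV[R]_n) : R :=
  \sum_(i < n) u 0 i * v 0 i.

(* Spheres are taken with respect to [dot]: the library's norm on row vectors
   is the sup norm. *)
Definition sphere (R : realType) (n : nat) (c : 'rV[R]_n) (r : R) :
    set 'rV[R]_n :=
  [set x | dot (x - c) (x - c) = r ^+ 2].

Definition convex_hull (R : realType) (n : nat) (S : set 'rV[R]_n) :
    set 'rV[R]_n :=
  smallest (@convex_set R 'rV[R]_n) S.

Definition flat (R : realType) (n : nat) (x : 'rV[R]_n)
    (U : {vspace 'rV[R]_n}) : set 'rV[R]_n :=
  [set x + u | u in [set` U]].

Definition affine_hull (R : realType) (n : nat) (S : set 'rV[R]_n) :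
    set 'rV[R]_n :=
  smallest [set A | exists x U, A = flat x U] S.

(* The empty set has no dimension in nat (conventionally it is -1). *)
Definition has_dim (R : realType) (n : nat) (S : set 'rV[R]_n) (k : nat) :
    Prop :=
  S !=set0 /\ exists x U, affine_hull S = flat x U /\ \dim U = k.

Definition dpolytope (R : realType) (d n : nat) (P : set 'rV[R]_n) : Prop :=
  (exists V : set 'rV[R]_n, finite_set V /\ P = convex_hull V) /\ has_dim P d.

(* [a = 0] is allowed: it yields the improper faces [set0] and [P]. *)
Definition is_face (R : realType) (n : nat) (P F : set 'rV[R]_n) : Prop :=
  exists (a : 'rV[R]_n) (b : R),
    (forall x, P x -> dot a x <= b) /\ F = P `&` [set x | dot a x = b].

Definition faces (R : realType) (n : nat) (P : set 'rV[R]_n) :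
    set (set 'rV[R]_n) :=
  [set F | is_face P F].

Definition faces_of_dim (R : realType) (n : nat) (P : set 'rV[R]_n)
    (i : nat) : set (set 'rV[R]_n) :=
  [set F | is_face P F /\ has_dim F i].

Definition vertices (R : realType) (n : nat) (P : set 'rV[R]_n) :
    set 'rV[R]_n :=
  [set v | is_face P [set v]].

Definition has_fvector (R : realType) (n : nat) (P : set 'rV[R]_n)
    (f : seq nat) : Prop :=
  forall i, (i < size f)%N -> faces_of_dim P i #= `I_(nth 0%N f i).

Definition comb_equiv (R : realType) (m n : nat) (P : set 'rV[R]_m)
    (Q : set 'rV[R]_n) : Prop :=
  exists2 h : set 'rV[R]_m -> set 'rV[R]_n,
    set_bij (faces P) (faces Q) h &
    forall F G, faces P F -> faces P G -> (F `<=` G <-> h F `<=` h G).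

(* An inscribed [d]-polytope is full-dimensional, so that the sphere in
   ['rV_d] is a (d-1)-sphere. *)
Definition inscribed (R : realType) (d : nat) (Q : set 'rV[R]_d) : Prop :=
  dpolytope d Q /\
  exists (c : 'rV[R]_d) (r : R), 0 < r /\ vertices Q `<=` sphere c r.

Definition inscribable (R : realType) (d n : nat) (P : set 'rV[R]_n) : Prop :=
  exists Q : set 'rV[R]_d, inscribed Q /\ comb_equiv P Q.

(* The ambient dimension [n] of [P] may exceed [size f]. *)
Definition fvector_inscribable (R : realType) (f : seq nat) : Prop :=
  exists (n : nat) (P : set 'rV[R]_n),
    [/\ dpolytope (size f) P, has_fvector P f & inscribable (size f) P].

(* Main.v *)
(* Two counts matter: [f_2 = 28 = 'C(8, 2)] and [f_3 = 8]. Every ridge of a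
   4-polytope is the meet of two facets, so any two of the 8 facets meet in a
   ridge lying in no third facet. Writing the polytope as [S_j >= 0] for 8 affine
   functions [S_j], this says that a nonzero linear dependency of the [S_j] has at
   least 3 positive and 3 negative coefficients. In particular any 5 of the [S_j]
   are independent, and the Gale dual is a configuration of 8 vectors in [R^3] in
   which every plane spanned by two vectors has 3 of the others on each side.
   A search over the signs of the 3 x 3 determinants of such a configuration shows
   that some facet F is a wedge: there are facets A, B, c1, ..., c5 such that
   a_i = F A c_i c_{i+1} and b_i = F B c_i c_{i+1} (i = 1, ..., 4) are vertices.
   If these 8 vertices lie on a sphere, the three circles through
   a_i, a_{i+1}, b_{i+1}, b_i force a1, a4, b1, b4 to be coplanar, as in a chain of
   three quadrilaterals between two lines (power of a point). Then
   S_F, S_c1, S_c2, S_c4, S_c5 vanish at a common point of projective space,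
   contradicting their independence. *)

(* The face numbers are those of [P], while the sphere belongs to another realization [Q]. So the
   adjacency of facets is phrased through inclusions of faces, carried along the isomorphism of face
   lattices, and turned into inequalities for [Q] only afterwards. The geometry of [Q] is done in
   [R^5]: a point [x] becomes [(1, x)], the functions [S_j] become linear, and the sphere becomes
   the zero set of a quadratic form. Lines that are parallel in [R^4] then need no separate case in
   the power of a point argument. The realization of [Q] is not known, so the wedge has to be found
   from signs alone. Any five [S_j] are independent, hence no determinant of three dual vectors
   vanishes and every sign is one bit. Vertices are read off by complements: a positive relation
   among four dual vectors is the slack vector of a point where the other four [S_j] vanish. *)
Require Import Defs.
From HB Require Import structures.
From mathcomp Require Import all_boot all_order all_algebra.
From mathcomp Require Import boolp classical_sets functions cardinality.
From mathcomp Require Import reals interval_inference convex.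
From mathcomp Require Import ring lra zify.

Set Implicit Arguments.
Unset Strict Implicit.
Unset Printing Implicit Defensive.

Import Order.TTheory GRing.Theory Num.Theory.

(** * Balanced chirotopes on 8 elements contain a wedge *)

(* For signs of determinants of vectors of [R^3]: the relation between a, b, c, d
   given by Cramer's rule has coefficients of one sign. *)
Definition pos_dependent (T : Type) (chi : T -> T -> T -> bool) (a b c d : T) :=
  [&& chi b c d == ~~ chi a c d, chi b c d == chi a b d &
      chi b c d == ~~ chi a b c].

(* The 4-sets listed are the complements of the vertices of the wedge; its facet F
   is the eighth element. *)
Definition is_wedge (T : Type) (chi : T -> T -> T -> bool)
    (A B c1 c2 c3 c4 c5 : T) :=
  [&& pos_dependent chi A c3 c4 c5, pos_dependent chi A c1 c4 c5,
      pos_dependent chi A c1 c2 c5, pos_dependent chi A c1 c2 c3,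
      pos_dependent chi B c3 c4 c5, pos_dependent chi B c1 c4 c5,
      pos_dependent chi B c1 c2 c5 & pos_dependent chi B c1 c2 c3].

(* [chi_gp]: the three terms of the Grassmann-Pluecker relation
   [det awx * det ayz - det awy * det axz + det awz * det axy = 0] do not all have
   the same sign. *)
Record balanced (T : finType) (chi : T -> T -> T -> bool) : Prop := Balanced {
  chi_cyc : forall i j k, chi i j k = chi j k i;
  chi_anti : forall i j k, uniq [:: i; j; k] -> chi j i k = ~~ chi i j k;
  chi_degen : forall i j, chi i j i = false;
  chi_count : forall i j, i != j -> #|[set k | chi i j k]| = 3;
  chi_gp : forall a w x y z, uniq [:: a; w; x; y; z] ->
    ~~ ((chi a w x == chi a y z) == ~~ (chi a w y == chi a x z)) ||
    ~~ ((chi a w x == chi a y z) == (chi a w z == chi a x y)) }.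

(* Partial assignments are nested lists, for the sake of [vm_compute]. *)
Definition partial := seq (seq (seq (option bool))).

Definition lookup (e : partial) (i j k : nat) : option bool :=
  nth None (nth [::] (nth [::] e i) j) k.

(** Only increasing triples are stored. The other orders follow from cyclicity and antisymmetry, and
    a triple with a repeated index has value [None]. *)
Definition value (e : partial) (i j k : nat) : option bool :=
  if i < j then
    if j < k then lookup e i j k
    else if k < i then lookup e k i j
    else if (i < k) && (k < j) then omap negb (lookup e i k j) else None
  else if j < i then
    if i < k then omap negb (lookup e j i k)
    else if k < j then omap negb (lookup e k j i)
    else if (j < k) && (k < i) then lookup e j k i else None
  else None.

(** An upper bound on the positive signs is enough: with [i] and [j] exchanged, the same bound
    limits the negative ones. *)
Definition balance_check (e : partial) i j :=
  count (fun k => value e i j k == Some true) (iota 0 8) <= 3.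

Definition gp_check (e : partial) a w x y z :=
  if value e a w x isn't Some p1 then true else
  if value e a y z isn't Some p2 then true else
  if value e a w y isn't Some q1 then true else
  if value e a x z isn't Some q2 then true else
  if value e a w z isn't Some r1 then true else
  if value e a x y isn't Some r2 then true else
  ~~ ((p1 == p2) == ~~ (q1 == q2)) || ~~ ((p1 == p2) == (r1 == r2)).

Definition triple := (nat * nat * nat)%type.

(** Only conditions involving the triple just assigned are tested: those of its pairs, and the
    relations having it in one of their products, with each of its elements in turn as the common
    index. *)
Definition check (e : partial) (t : triple) :=
  let: (i, j, k) := t in
  [&& balance_check e i j, balance_check e j i, balance_check e i k,
      balance_check e k i, balance_check e j k, balance_check e k j &
      all (fun y => all (fun z =>
        [&& gp_check e i j k y z, gp_check e j i k y z & gp_check e k i j y z])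
        (iota y.+1 (7 - y))) (iota 0 8)].

Definition extend (e : partial) (t : triple) (s : bool) : partial :=
  let: (i, j, k) := t in
  let ei := nth [::] e i in
  set_nth [::] e i (set_nth [::] ei j (set_nth None (nth [::] ei j) k (Some s))).

Lemma lookup_extend e i j k s a b c : lookup (extend e (i, j, k) s) a b c =
  if [&& a == i, b == j & c == k] then Some s else lookup e a b c.
Proof.
rewrite /lookup /extend nth_set_nth /=; case: eqP => //= ->.
by rewrite nth_set_nth /=; case: eqP => //= ->; rewrite nth_set_nth /=; case: eqP.
Qed.

Definition pos_dependent_check (e : partial) a b c d :=
  match value e b c d, value e a c d, value e a b d, value e a b c with
  | Some s1, Some s2, Some s3, Some s4 => [&& s1 == ~~ s2, s1 == s3 & s1 == ~~ s4]
  | _, _, _, _ => false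
  end.

Definition wedge_check (e : partial) (w : seq nat) :=
  if w is [:: F; A; B; c1; c2; c3; c4; c5] then
    [&& pos_dependent_check e A c3 c4 c5, pos_dependent_check e A c1 c4 c5,
        pos_dependent_check e A c1 c2 c5, pos_dependent_check e A c1 c2 c3,
        pos_dependent_check e B c3 c4 c5, pos_dependent_check e B c1 c4 c5,
        pos_dependent_check e B c1 c2 c5 & pos_dependent_check e B c1 c2 c3]
  else false.

Arguments check : simpl never.
Arguments extend : simpl never.

Fixpoint search (wedges : seq (seq nat)) (todo : seq triple) (e : partial) :=
  if todo is t :: todo' then
    let e1 := extend e t true in let e2 := extend e t false in
    (if check e1 t then search wedges todo' e1 else true) &&
    (if check e2 t then search wedges todo' e2 else true)
  else has (wedge_check e) wedges.

(** * Soundness of the sign search *)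

Section Soundness.
Variables (T : finType) (chi : T -> T -> T -> bool) (p : nat -> T).
Hypothesis balanced_chi : balanced chi.
Hypothesis p_inj : {in [pred i | i < 8] &, injective p}.

Definition agrees (e : partial) := forall i j k s,
  lookup e i j k = Some s -> [&& i < j, j < k & k < 8] /\ chi (p i) (p j) (p k) = s.

Lemma p_uniq (s : seq nat) : uniq s -> all (fun i => i < 8) s -> uniq (map p s).
Proof.
move=> us /allP s8; rewrite map_inj_in_uniq // => i j /s8 i8 /s8 j8; exact: p_inj.
Qed.

Lemma valueP e i j k s : agrees e -> value e i j k = Some s ->
  [/\ uniq [:: i; j; k], all (fun i => i < 8) [:: i; j; k] &
      chi (p i) (p j) (p k) = s].
Proof.
move=> ag; pose X i j k := chi (p i) (p j) (p k).
have ag3 a b c r : lookup e a b c = Some r ->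
    [/\ a < b, b < c, c < 8, X a b c = r & X b a c = ~~ r].
  move=> /ag[/and3P[ab bc c8] abc]; split => //.
  rewrite /X (chi_anti balanced_chi) ?abc //.
  by apply: (@p_uniq [:: a; b; c]) => /=; rewrite ?inE; lia.
have cyc a b c : X a b c = X b c a := chi_cyc balanced_chi _ _ _.
have fin r : X i j k = r -> i != j -> j != k -> i != k -> i < 8 -> j < 8 -> k < 8 ->
    [/\ uniq [:: i; j; k], all (fun i => i < 8) [:: i; j; k] & X i j k = r].
  by move=> Xs ij jk ik i8 j8 k8; rewrite /= !inE negb_or ij jk ik i8 j8 k8.
rewrite /value -/(X i j k); case: ifP => ij; last case: ifP => // ji.
- case: ifP => jk; last case: ifP => ki; last case: ifP => // /andP[ik kj].
  + by move=> /ag3[? ? ? ? ?]; apply: fin; lia.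
  + by move=> /ag3[? ? ? Xs _]; apply: fin; rewrite -?(cyc k i j) //; lia.
  + case E: (lookup e i k j) => [r|] //= [<-]; have [? ? ? _ Xs] := ag3 _ _ _ _ E.
    by apply: fin; rewrite -?(cyc k i j) //; lia.
- case: ifP => jk; last case: ifP => ki; last case: ifP => // /andP[ik kj].
  + case E: (lookup e j i k) => [r|] //= [<-]; have [? ? ? _ Xs] := ag3 _ _ _ _ E.
    by apply: fin => //; lia.
  + case E: (lookup e k j i) => [r|] //= [<-]; have [? ? ? _ Xs] := ag3 _ _ _ _ E.
    by apply: fin; rewrite ?(cyc i j k) //; lia.
  + by move=> /ag3[? ? ? Xs _]; apply: fin; rewrite ?(cyc i j k) //; lia.
Qed.

Let X i j k := chi (p i) (p j) (p k).

Lemma balance_check_sound e i j : agrees e -> i != j -> i < 8 -> j < 8 ->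
  balance_check e i j.
Proof.
move=> ag ij i8 j8; rewrite /balance_check -size_filter.
rewrite -[leqRHS](chi_count balanced_chi (_ : p i != p j)); last first.
  by rewrite (inj_in_eq p_inj).
rewrite -(size_map p) cardE; apply: uniq_leq_size.
  rewrite map_inj_in_uniq ?filter_uniq ?iota_uniq // => k l.
  rewrite !mem_filter !mem_iota !add0n => /and3P[_ _ k8] /and3P[_ _ l8].
  by move/p_inj; apply; rewrite inE.
move=> _ /mapP[k + ->]; rewrite mem_filter => /andP[/eqP/(valueP ag)[_ _ ijk] _].
by rewrite mem_enum inE.
Qed.

Lemma gp_check_sound e a w x y z : agrees e -> gp_check e a w x y z.
Proof.
move=> ag; rewrite /gp_check.
case E1: (value e a w x) => [p1|] //; have [u1 b1 <-] := valueP ag E1.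
case E2: (value e a y z) => [p2|] //; have [u2 b2 <-] := valueP ag E2.
case E3: (value e a w y) => [q1|] //; have [u3 _ <-] := valueP ag E3.
case E4: (value e a x z) => [q2|] //; have [u4 _ <-] := valueP ag E4.
case E5: (value e a w z) => [r1|] //; have [u5 _ <-] := valueP ag E5.
case E6: (value e a x y) => [r2|] //; have [u6 _ <-] := valueP ag E6.
apply: (chi_gp balanced_chi); apply: (@p_uniq [:: a; w; x; y; z]).
  move: u1 u2 u3 u4 u5 u6; rewrite /= !inE; lia.
by move: b1 b2; rewrite /=; lia.
Qed.

Lemma extend_agrees e i j k : agrees e -> [&& i < j, j < k & k < 8] ->
  agrees (extend e (i, j, k) (X i j k)).
Proof.
move=> ag ijk a b c s; rewrite lookup_extend; case: and3P => [[/eqP-> /eqP-> /eqP->]|_].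
  by move=> [<-].
exact: ag.
Qed.

Lemma check_sound e i j k : agrees e -> [&& i < j, j < k & k < 8] ->
  check e (i, j, k).
Proof.
move=> ag /and3P[ij jk k8]; have j8 := ltn_trans jk k8; have i8 := ltn_trans ij j8.
have ik := ltn_trans ij jk.
have B a b : a != b -> a < 8 -> b < 8 -> balance_check e a b.
  exact: balance_check_sound.
rewrite /check; set gps := all _ _; have -> : gps.
  by apply/allP => y _; apply/allP => z _; rewrite !gp_check_sound.
by rewrite !B // neq_ltn ?ij ?jk ?ik ?orbT.
Qed.

Definition wedge_at (w : seq nat) : bool :=
  if w is [:: F; A; B; c1; c2; c3; c4; c5]
  then is_wedge chi (p A) (p B) (p c1) (p c2) (p c3) (p c4) (p c5) else false.

Lemma wedge_check_sound e w : agrees e -> wedge_check e w -> wedge_at w.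
Proof.
move=> ag; have pd a b c d : pos_dependent_check e a b c d ->
    pos_dependent chi (p a) (p b) (p c) (p d).
  rewrite /pos_dependent_check.
  case E1: (value e b c d) => [s1|] //; have [_ _ <-] := valueP ag E1.
  case E2: (value e a c d) => [s2|] //; have [_ _ <-] := valueP ag E2.
  case E3: (value e a b d) => [s3|] //; have [_ _ <-] := valueP ag E3.
  by case E4: (value e a b c) => [s4|] //; have [_ _ <-] := valueP ag E4.
rewrite /wedge_at /is_wedge; do 8![case: w => // ? w]; case: w => [|? ?] //.
move=> /andP[/pd-> /andP[/pd-> /andP[/pd-> /andP[/pd-> wB]]]].
by move: wB => /and4P[/pd-> /pd-> /pd-> /pd->].
Qed.

Lemma search_sound ws todo e : agrees e ->
    all (fun t : triple => [&& t.1.1 < t.1.2, t.1.2 < t.2 & t.2 < 8]) todo ->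
    search ws todo e -> exists2 w, w \in ws & wedge_at w.
Proof.
elim: todo e => [|[[i j] k] todo IH] e ag /=.
  by move=> _ /hasP[w ww /(wedge_check_sound ag) wedge_w]; exists w.
move=> /andP[/= ijk todo8] /andP[s1 s2].
have ag' := extend_agrees ag ijk; have ok := check_sound ag' ijk.
by case XE: (X i j k) ag' ok => ag' ok; [move: s1|move: s2]; rewrite ok; apply: IH.
Qed.

End Soundness.

(* The vectors are labelled so that the plane of vectors 7 and 0 separates 1, 2, 3
   from 4, 5, 6, and each of these triples is sorted around vector 7. *)
Definition normal_triples : seq (triple * bool) :=
  [:: (0, 1, 7, true); (0, 2, 7, true); (0, 3, 7, true); (0, 4, 7, false);
      (0, 5, 7, false); (0, 6, 7, false); (1, 2, 7, true); (1, 3, 7, true);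
      (2, 3, 7, true); (4, 5, 7, true); (4, 6, 7, true); (5, 6, 7, true)].

Definition normal_start : partial :=
  foldr (fun ts e => extend e ts.1 ts.2) [::] normal_triples.

Definition remaining_triples : seq triple :=
  [seq (i, j, 7) | i <- [:: 1; 2; 3], j <- [:: 4; 5; 6]] ++
  [seq t <- [seq (ij.1, ij.2, k) | ij <- [seq (i, j) | i <- iota 0 7, j <- iota 0 7],
     k <- iota 0 7] | (t.1.1 < t.1.2) && (t.1.2 < t.2)].

(* Entries of a row: F, A, B, c1, c2, c3, c4, c5. *)
Definition wedge_list : seq (seq nat) :=
  [:: [:: 4; 0; 1; 3; 6; 7; 2; 5]; [:: 3; 0; 6; 2; 5; 7; 1; 4];
      [:: 4; 0; 1; 3; 6; 2; 7; 5]; [:: 0; 3; 4; 1; 5; 2; 6; 7];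
      [:: 3; 0; 6; 2; 5; 1; 7; 4]; [:: 4; 0; 1; 5; 2; 6; 3; 7];
      [:: 3; 0; 6; 2; 5; 1; 4; 7]; [:: 5; 1; 2; 4; 0; 3; 7; 6];
      [:: 4; 0; 1; 3; 6; 2; 5; 7]; [:: 5; 1; 2; 4; 0; 7; 3; 6];
      [:: 3; 0; 6; 2; 7; 5; 1; 4]; [:: 3; 0; 6; 4; 1; 5; 2; 7];
      [:: 2; 5; 6; 1; 4; 7; 0; 3]; [:: 6; 2; 3; 0; 4; 7; 1; 5];
      [:: 1; 4; 5; 0; 3; 7; 6; 2]; [:: 0; 3; 4; 1; 7; 5; 2; 6];
      [:: 0; 3; 4; 6; 2; 5; 1; 7]; [:: 0; 3; 4; 1; 5; 7; 2; 6];
      [:: 4; 0; 1; 3; 7; 6; 2; 5]; [:: 6; 2; 3; 5; 1; 4; 0; 7];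
      [:: 1; 4; 5; 0; 7; 3; 6; 2]; [:: 7; 1; 5; 0; 4; 2; 6; 3];
      [:: 5; 1; 2; 4; 0; 3; 6; 7]; [:: 4; 0; 7; 2; 5; 1; 3; 6];
      [:: 7; 1; 4; 3; 0; 5; 2; 6]; [:: 1; 4; 7; 3; 0; 5; 2; 6];
      [:: 3; 0; 7; 1; 4; 6; 2; 5]; [:: 7; 2; 6; 0; 3; 5; 1; 4];
      [:: 7; 2; 6; 1; 5; 3; 0; 4]; [:: 5; 1; 7; 0; 4; 2; 6; 3];
      [:: 1; 4; 5; 0; 3; 6; 2; 7]; [:: 0; 3; 7; 2; 6; 4; 1; 5];
      [:: 7; 0; 3; 1; 4; 6; 2; 5]; [:: 7; 0; 4; 2; 6; 3; 1; 5];
      [:: 7; 0; 4; 2; 5; 1; 3; 6]].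

(** The tree branches over the 44 signs that [normal_triples] leaves open and is pruned after each
    of them. The rows of [wedge_list] are certified by this run alone: every surviving leaf contains
    one of them. *)
Lemma search_wedge : search wedge_list remaining_triples normal_start.
Proof. by vm_compute. Qed.


(** A tournament on three points is a linear order unless it is a cycle, and the last hypothesis
    forbids cycles. *)
Lemma sort_transitive_triple (T : eqType) (r : rel T) (s : seq T) :
    size s = 3 -> uniq s -> {in s &, forall x y, x != y -> r y x = ~~ r x y} ->
    (forall x y z, uniq [:: x; y; z] -> {subset [:: x; y; z] <= s} ->
      ~~ (r x y == ~~ r x z) || ~~ (r x y == r y z)) ->
  exists y1 y2 y3, [/\ perm_eq [:: y1; y2; y3] s, r y1 y2, r y1 y3 & r y2 y3].
Proof.
case: s => [|x1 [|x2 [|x3 []]]] // _ us anti cyc; move: (us).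
rewrite /= !inE negb_or => /and3P[/andP[n12 n13] n23 _].
have := cyc x1 x2 x3 us (fun _ => id).
have := anti x1 x2; have := anti x1 x3; have := anti x2 x3.
rewrite !inE !eqxx ?orbT.
move=> /(_ isT isT n23) a23 /(_ isT isT n13) a13 /(_ isT isT n12) a12.
have perm3 y1 y2 y3 : perm_eq [:: y1; y2; y3] [:: x1; x2; x3] ->
    r y1 y2 -> r y1 y3 -> r y2 y3 ->
    exists y1 y2 y3, [/\ perm_eq [:: y1; y2; y3] [:: x1; x2; x3],
      r y1 y2, r y1 y3 & r y2 y3].
  by move=> *; exists y1, y2, y3.
case E12: (r x1 x2) a12; case E13: (r x1 x3) a13;
  case E23: (r x2 x3) a23 => //= e32 e31 e21 _.
- by apply: (perm3 x1 x2 x3).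
- by apply: (perm3 x1 x3 x2) => //; apply/permP => q /=;
    case: (q x1); case: (q x2); case: (q x3).
- by apply: (perm3 x3 x1 x2) => //; apply/permP => q /=;
    case: (q x1); case: (q x2); case: (q x3).
- by apply: (perm3 x2 x1 x3) => //; apply/permP => q /=;
    case: (q x1); case: (q x2); case: (q x3).
- by apply: (perm3 x2 x3 x1) => //; apply/permP => q /=;
    case: (q x1); case: (q x2); case: (q x3).
- by apply: (perm3 x3 x2 x1) => //; apply/permP => q /=;
    case: (q x1); case: (q x2); case: (q x3).
Qed.

Theorem balanced_wedge (T : finType) (chi : T -> T -> T -> bool) :
    #|T| = 8 -> balanced chi ->
  exists F A B c1 c2 c3 c4 c5, uniq [:: F; A; B; c1; c2; c3; c4; c5] /\
    is_wedge chi A B c1 c2 c3 c4 c5.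
Proof.
move=> T8 bal.
have [z [x0 [_ _ zx0]]] : exists x y, [/\ x \in T, y \in T & x != y].
  by apply/card_gt1P; rewrite T8.
have degen2 i j : chi i j j = false by rewrite 2!(chi_cyc bal) (chi_degen bal).
(* Projected along [z], the three vectors on one side of the plane of [z] and [x0] lie in an open
   half-plane, where turning around [z] is a linear order. The Grassmann-Pluecker relation with
   common vector [z] expresses this: the three signs that involve [x0] are all [b]. *)
have side (u v : T) b : u != v -> z \in [:: u; v] ->
    (forall k, chi u v k -> k != x0 /\ chi z x0 k = b) ->
    exists y1 y2 y3, [/\ perm_eq [:: y1; y2; y3] (enum [set k | chi u v k]),
      chi z y1 y2, chi z y1 y3 & chi z y2 y3].
  move=> uv zuv chi_b.
  have nz x : chi u v x -> x != z.
    by move=> ux; apply/eqP => xz; move: zuv ux; rewrite xz !inE => /orP[]/eqP->;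
      rewrite ?(chi_degen bal) ?degen2.
  apply: sort_transitive_triple.
  - by rewrite -cardE (chi_count bal).
  - exact: enum_uniq.
  - move=> x y; rewrite !mem_enum !inE => /nz xz /nz yz xy.
    by rewrite !(chi_cyc bal z) (chi_anti bal) //= !inE negb_or xy xz yz.
  - move=> x y t xyt sub.
    have S w : w \in [:: x; y; t] -> [/\ w != z, w != x0 & chi z x0 w = b].
      by move=> /sub; rewrite mem_enum inE => uw; have [? ?] := chi_b _ uw;
        rewrite nz.
    have [|xz xx0 xb] := S x; first by rewrite !inE eqxx.
    have [|yz yx0 yb] := S y; first by rewrite !inE eqxx orbT.
    have [|tz tx0 tb] := S t; first by rewrite !inE eqxx !orbT.
    have /(chi_gp bal) : uniq [:: z; x0; x; y; t].
      rewrite 2!cons_uniq xyt !inE !negb_or zx0 ![z == _]eq_sym ![x0 == _]eq_sym.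
      by rewrite xz yz tz xx0 yx0 tx0.
    rewrite xb yb tb.
    by case: b {chi_b S xb yb tb}; case: (chi z x y); case: (chi z x t);
      case: (chi z y t).
have chi_x0 k : chi z x0 k -> k != x0.
  by apply: contraTneq => ->; rewrite degen2.
have chi_z k : chi z x0 k -> k != z.
  by apply: contraTneq => ->; rewrite (chi_degen bal).
have chi_x0' k : chi x0 z k -> k != x0.
  by apply: contraTneq => ->; rewrite (chi_degen bal).
have chi_z' k : chi x0 z k -> k != z.
  by apply: contraTneq => ->; rewrite degen2.
have anti k : k != x0 -> k != z -> chi x0 z k = ~~ chi z x0 k.
  by move=> kx kz; rewrite (chi_anti bal) //= !inE negb_or zx0 ![_ == k]eq_sym kx kz.
have [||y1 [y2 [y3 [permA c12 c13 c23]]]] := side z x0 true zx0.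
- by rewrite !inE eqxx.
- by move=> k zk; rewrite chi_x0.
have [|||y4 [y5 [y6 [permB c45 c46 c56]]]] := side x0 z false.
- by rewrite eq_sym.
- by rewrite !inE eqxx orbT.
- by move=> k xk; rewrite chi_x0' //; have := anti _ (chi_x0' _ xk) (chi_z' _ xk);
    rewrite xk; case: (chi z x0 k).
have memA y : y \in [:: y1; y2; y3] -> chi z x0 y.
  by rewrite (perm_mem permA) mem_enum inE.
have memB y : y \in [:: y4; y5; y6] -> chi x0 z y.
  by rewrite (perm_mem permB) mem_enum inE.
have memB' y : y \in [:: y4; y5; y6] -> chi z x0 y = false.
  move=> /memB xy; have := anti _ (chi_x0' _ xy) (chi_z' _ xy).
  by rewrite xy; case: (chi z x0 y).
pose s := ([:: x0; y1; y2; y3] ++ [:: y4; y5; y6]) ++ [:: z].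
have us : uniq s.
  rewrite /s cats1 rcons_uniq cat_uniq cons_uniq.
  rewrite (perm_uniq permA) (perm_uniq permB) !enum_uniq andbT.
  have x0A : x0 \notin [:: y1; y2; y3] by apply/negP => /memA/chi_x0; rewrite eqxx.
  have zA : z \notin [:: y1; y2; y3] by apply/negP => /memA/chi_z; rewrite eqxx.
  have x0B : x0 \notin [:: y4; y5; y6] by apply/negP => /memB/chi_x0'; rewrite eqxx.
  have zB : z \notin [:: y4; y5; y6] by apply/negP => /memB/chi_z'; rewrite eqxx.
  have AB : ~~ has (mem [:: x0; y1; y2; y3]) [:: y4; y5; y6].
    apply/hasPn => y yB; suff : y \notin [:: x0; y1; y2; y3] by [].
    rewrite in_cons negb_or; apply/andP; split.
      by apply: contraNneq x0B => <-.
    by apply/negP => /memA; rewrite memB'.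
  by rewrite mem_cat negb_or zB in_cons negb_or zx0 zA x0A AB.
pose p i := nth x0 s i.
have p_inj : {in [pred i | i < 8] &, injective p}.
  by move=> i j; rewrite !inE => i8 j8 /eqP; rewrite nth_uniq // => /eqP.
have ag : agrees chi p normal_start.
  have rot i j : chi i j z = chi z i j by rewrite (chi_cyc bal z).
  have A1 : chi z x0 y1 by rewrite memA // !inE eqxx.
  have A2 : chi z x0 y2 by rewrite memA // !inE eqxx ?orbT.
  have A3 : chi z x0 y3 by rewrite memA // !inE eqxx ?orbT.
  have B4 : chi z x0 y4 = false by rewrite memB' // !inE eqxx.
  have B5 : chi z x0 y5 = false by rewrite memB' // !inE eqxx ?orbT.
  have B6 : chi z x0 y6 = false by rewrite memB' // !inE eqxx ?orbT.
  have step e i j k b : agrees chi p e -> [&& i < j, j < k & k < 8] ->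
      chi (p i) (p j) (p k) = b -> agrees chi p (extend e (i, j, k) b).
    by move=> age ijk <-; apply: extend_agrees.
  rewrite /normal_start /=; do 12![apply: (step); [|by []|by rewrite /p /= rot]].
  by move=> i j k b; rewrite /lookup !nth_nil.
have [|w wW] := search_sound bal p_inj ag _ search_wedge; first by vm_compute.
have w_perm : perm_eq w (iota 0 8).
  have /allP/(_ w wW) : all (fun w => perm_eq w (iota 0 8)) wedge_list by vm_compute.
  by [].
have uw : uniq (map p w).
  apply: p_uniq => //; first by rewrite (perm_uniq w_perm) iota_uniq.
  by apply/allP => i; rewrite (perm_mem w_perm) mem_iota.
clear wW w_perm; move: uw; rewrite /wedge_at; do 8![case: w => // ? w].
case: w => [|? ?] // uw wedge_w.
by do 8!eexists; split; [exact: uw|exact: wedge_w].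
Qed.

Local Open Scope ring_scope.

(** * Gale duality *)

Lemma ord_notin N (A : {set 'I_N}) : (#|A| < N)%N -> exists i, i \notin A.
Proof.
move=> AN; apply/existsP; apply: contraLR AN; rewrite negb_exists -leqNgt.
by move=> /forallP AT; rewrite -{1}[N]card_ord subset_leq_card //;
  apply/fintype.subsetP => i _; have := AT i; rewrite negbK.
Qed.

Section GaleDual.
Variables (R : realFieldType) (N : 'M[R]_(5, 8)).

(** Column [j] of [N] is the affine function of facet [j], and [v] is a point in homogeneous
    coordinates. *)
Definition slack (v : 'rV[R]_5) (j : 'I_8) : R := (v *m N) 0 j.

Lemma slackD v w j : slack (v + w) j = slack v j + slack w j.
Proof. by rewrite /slack mulmxDl mxE. Qed.

Lemma slackZ k v j : slack (k *: v) j = k * slack v j.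
Proof. by rewrite /slack -scalemxAl mxE. Qed.

Lemma slackB v w j : slack (v - w) j = slack v j - slack w j.
Proof. by rewrite slackD -scaleN1r slackZ mulN1r. Qed.

Hypothesis slack_pair : forall i j, i != j ->
  exists v, [/\ slack v i = 0, slack v j = 0 &
    forall k, k != i -> k != j -> 0 < slack v k].

Definition dependency (l : 'rV[R]_8) := l *m N^T = 0.

Lemma dependency_slack l v : dependency l -> \sum_j l 0 j * slack v j = 0.
Proof.
move=> ld; have : (l *m N^T *m v^T) 0 0 = 0 by rewrite ld mul0mx mxE.
rewrite -mulmxA -trmx_mul mxE => E.
by rewrite -[RHS]E; apply: eq_bigr => j _; rewrite mxE.
Qed.

Lemma dependencyN l : dependency l -> dependency (- l).
Proof. by rewrite /dependency mulNmx => ->; rewrite oppr0. Qed.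

(** If no coefficient off [p] and [q] is positive, evaluation at an interior point of the ridge of
    [p] and [q] makes all of these zero. Evaluation on the ridge of a third index and one of [p],
    [q] then kills the coefficient of the other. *)
Lemma dependency_pos l p q : dependency l -> l != 0 ->
  exists k, [/\ k != p, k != q & 0 < l 0 k].
Proof.
move=> ld; wlog pq : q / p != q.
  move=> wl l0; have [pq|] := eqVneq p q; last by move=> pq; apply: wl.
  have [|r] := @ord_notin _ [set p]; first by rewrite cards1.
  rewrite inE eq_sym => pr.
  by have [k [kp _ lk]] := wl r pr l0; exists k; rewrite -pq.
move=> l0; suff /existsP[k /and3P[]] : [exists k, [&& k != p, k != q & 0 < l 0 k]].
  by exists k.
apply: contraR l0; rewrite negb_exists => /forallP nok.
apply/eqP/rowP => k; rewrite mxE.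
have le0 j : j != p -> j != q -> l 0 j <= 0.
  by move=> jp jq; have := nok j; rewrite jp jq /= -leNgt.
have z0 j : j != p -> j != q -> l 0 j = 0.
  move=> jp jq; have [v [vp vq vpos]] := slack_pair pq.
  have /eqP := dependency_slack v ld.
  rewrite -oppr_eq0 -sumrN psumr_eq0 => [/allP/(_ j (mem_index_enum j))|i _].
    by rewrite oppr_eq0 mulf_eq0 [slack v j == 0]gt_eqF ?vpos // orbF => /eqP.
  have [->|ip] := eqVneq i p; first by rewrite vp mulr0 oppr0.
  have [->|iq] := eqVneq i q; first by rewrite vq mulr0 oppr0.
  by rewrite oppr_ge0 mulr_le0_ge0 ?le0 // ltW ?vpos.
have [|r] := @ord_notin _ [set p; q]; first by rewrite cards2 pq.
rewrite !inE negb_or => /andP[rp rq].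
have single j j' : j != j' -> r != j -> r != j' ->
    (forall i, i != j -> i != j' -> l 0 i = 0) -> l 0 j = 0.
  move=> jj' rj rj' z; have [v [vr vj' vpos]] := slack_pair rj'.
  have := dependency_slack v ld; rewrite (bigD1 j) //= big1 ?addr0 => [/eqP|i ij].
    rewrite mulf_eq0 [slack v j == 0]gt_eqF ?orbF => [/eqP //|].
    by apply: vpos => //; rewrite eq_sym.
  by have [->|ij'] := eqVneq i j'; [rewrite vj' mulr0|rewrite z ?mul0r].
have [->|kp] := eqVneq k p; first exact: (single p q).
have [->|kq] := eqVneq k q; last exact: z0.
by apply: (single q p) => //; [rewrite eq_sym|move=> i iq ip; apply: z0].
Qed.

Lemma dependency_card l : dependency l -> l != 0 -> (2 < #|[set k | (0 < l 0 k)%R]|)%N.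
Proof.
move=> ld l0; have [x [_ _ lx]] := dependency_pos 0 0 ld l0.
have [y [yx _ ly]] := dependency_pos x x ld l0.
have [z [zx zy lz]] := dependency_pos x y ld l0.
apply/card_gt2P; exists x, y, z; rewrite !inE lx ly lz; split => //.
by split=> //; rewrite eq_sym.
Qed.

Lemma dependency_support l (A : {set 'I_8}) : dependency l ->
  (forall k, k \notin A -> l 0 k = 0) -> (#|A| < 6)%N -> l = 0.
Proof.
move=> ld lA A6; apply/eqP; apply: contraLR A6 => l0; rewrite -leqNgt.
have := dependency_card ld l0.
have := dependency_card (dependencyN ld) (_ : - l != 0); rewrite oppr_eq0 => /(_ l0).
set P := [set _ | _]; set P' := [set _ | _] => cP cP'.
have dis : P :&: P' = finset.set0.
  by apply/finset.setP => k; rewrite !inE mxE; apply/negP => /andP[]; lra.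
have : P :|: P' \subset A.
  apply/fintype.subsetP => k; rewrite !inE mxE; apply: contraLR => /lA ->.
  by rewrite oppr0 ltxx.
move=> /subset_leq_card; apply: leq_trans; rewrite cardsU dis cards0 subn0.
by move: cP cP'; lia.
Qed.

(** A nonzero common zero makes the 5 x 5 submatrix of the five columns singular. A kernel vector on
    the other side is a dependency supported on at most five indices, hence zero. *)
Lemma five_slacks (t : 5.-tuple 'I_8) v : uniq t ->
  (forall j, j \in t -> slack v j = 0) -> v = 0.
Proof.
move=> /tuple_uniqP t_inj vt; apply/eqP; apply: contraT => v0.
pose E : 'M[R]_(5, 8) := \matrix_(c, k) (tnth t c == k)%:R.
have : \det (N *m E^T) == 0.
  apply/det0P; exists v => //; rewrite mulmxA; apply/rowP => c.
  rewrite !mxE (bigD1 (tnth t c)) //= big1 ?addr0 => [|k kc].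
    by rewrite -/(slack v _) vt ?mem_tnth // mul0r.
  by rewrite !mxE [_ == k]eq_sym (negPf kc) mulr0.
rewrite -det_tr => /det0P[w w0]; rewrite trmx_mul trmxK mulmxA => wE.
case/eqP: w0; have lE c : (w *m E) 0 (tnth t c) = w 0 c.
  rewrite mxE (bigD1 c) //= big1 ?addr0 => [|d dc]; rewrite mxE.
    by rewrite eqxx mulr1.
  by rewrite (inj_eq t_inj) (negPf dc) mulr0.
have l0 : w *m E = 0.
  apply: (dependency_support (A := [set k in t]) wE) => [k|].
    rewrite inE => kt; rewrite mxE big1 // => c _; rewrite mxE.
    by case: eqP kt => [<-|]; rewrite ?mem_tnth ?mulr0.
  by rewrite cardsE (leq_ltn_trans (card_size _)) // size_tuple.
by apply/rowP => c; rewrite -lE l0 !mxE.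
Qed.

(** The rows of [G] are a basis of the dependencies, of dimension 8 - 5, and its columns are the
    dual vectors. The last clause is a double orthogonal complement, obtained by counting
    dimensions. *)
Lemma gale_dual_exists : row_free N -> exists G : 'M[R]_(3, 8),
  [/\ row_free G, G *m N^T = 0 &
    forall s : 'rV[R]_8, s *m G^T = 0 -> exists v, s = v *m N].
Proof.
move=> slack_inj; have rk : \rank (kermx N^T) = 3%N.
  by rewrite mxrank_ker mxrank_tr (eqP slack_inj).
have [G Gfree GE] : exists2 G : 'M[R]_(3, 8), row_free G & (G :=: kermx N^T)%MS.
  move: (row_base (kermx N^T)) (row_base_free (kermx N^T)) (eq_row_base (kermx N^T)).
  by rewrite rk => G Gf GE; exists G.
have GN : G *m N^T = 0 by apply/sub_kermxP; rewrite -GE.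
exists G; split=> // s sG.
have NG : (N <= kermx G^T)%MS.
  by apply/sub_kermxP; rewrite -[N]trmxK -trmx_mul GN trmx0.
have NE : (N :=: kermx G^T)%MS.
  apply/eqmxP; rewrite -(mxrank_leqif_eq NG) mxrank_ker mxrank_tr.
  by rewrite (eqP Gfree) (eqP slack_inj).
have /submxP[v ->] : (s <= N)%MS by rewrite NE; apply/sub_kermxP.
by exists v.
Qed.

End GaleDual.

(** * Determinants of three vectors *)

Section Chirotope.
Variables (R : realFieldType) (n : nat) (G : 'M[R]_(3, n)).

Let g0 k := G ord0 k.
Let g1 k := G (lift ord0 ord0) k.
Let g2 k := G (lift ord0 (lift ord0 ord0)) k.

(** The expansion is written out so that the identities below are left to [ring]; [det3E] identifies
    it with the determinant. *)
Definition det3 i j k := g0 k * (g1 i * g2 j - g2 i * g1 j) +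
  g1 k * (g2 i * g0 j - g0 i * g2 j) + g2 k * (g0 i * g1 j - g1 i * g0 j).

Lemma det3E i j k : \det (\matrix_(r, c < 3) G r (tnth [tuple i; j; k] c)) = det3 i j k.
Proof.
rewrite (expand_det_row _ ord0) !big_ord_recl big_ord0 /cofactor.
rewrite !(expand_det_row _ (ord0 : 'I_2)) !big_ord_recl !big_ord0 /cofactor !det_mx11.
rewrite !mxE /=.
rewrite /det3 /g0 /g1 /g2.
rewrite !(tnth_nth i) /= /bump /= !addn0 !add0n !addn1 expr0 expr1 sqrrN expr1n.
have -> : 0 = ord0 :> 'I_1 by apply: val_inj.
ring.
Qed.

Lemma det3_cyc i j k : det3 i j k = det3 j k i.
Proof. by rewrite /det3; ring. Qed.

Lemma det3_anti i j k : det3 j i k = - det3 i j k.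
Proof. by rewrite /det3; ring. Qed.

Lemma det3_gp a w x y z : det3 a w x * det3 a y z - det3 a w y * det3 a x z +
  det3 a w z * det3 a x y = 0.
Proof. by rewrite /det3; ring. Qed.

(** The coefficients are the cross product of columns [i] and [j]. For a Gale dual [G], the
    determinants thus form a dependency, whose signs can be counted. *)
Lemma det3_row i j : exists y : 'rV_3, forall k, (y *m G) 0 k = det3 i j k.
Proof.
pose f (r : 'I_3) := if val r is 0 then g1 i * g2 j - g2 i * g1 j
  else if val r is 1 then g2 i * g0 j - g0 i * g2 j else g0 i * g1 j - g1 i * g0 j.
exists (\row_r f r) => k; rewrite mxE !big_ord_recl big_ord0 !mxE /f /=.
by rewrite /det3 /g0 /g1 /g2; ring.
Qed.

Lemma det3_relation a b c d r :
  det3 b c d * G r a - det3 a c d * G r b + det3 a b d * G r c - det3 a b c * G r d = 0.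
Proof.
rewrite /det3 /g0 /g1 /g2; have [->|[->|->]] : r = ord0 \/ r = lift ord0 ord0 \/
    r = lift ord0 (lift ord0 ord0).
- case: r => -[|[|[|//]]] r3; [left|right; left|right; right]; exact: val_inj.
- ring.
- ring.
- ring.
Qed.

End Chirotope.

(** * The Gale dual is balanced, and its positive relations are points *)

Section BalancedGale.
Variables (R : realFieldType) (N : 'M[R]_(5, 8)) (G : 'M[R]_(3, 8)).
Local Notation slack := (slack N).
Hypothesis slack_pair : forall i j, i != j ->
  exists v, [/\ slack v i = 0, slack v j = 0 &
    forall k, k != i -> k != j -> 0 < slack v k].
Hypothesis G_free : row_free G.
Hypothesis GN : G *m N^T = 0.
Hypothesis G_total : forall s : 'rV[R]_8, s *m G^T = 0 -> exists v, s = v *m N.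
Local Notation D := (det3 G).

Definition chi i j k := 0 < D i j k.

Lemma gale_dependency (y : 'rV_3) : dependency N (y *m G).
Proof. by rewrite /dependency -mulmxA GN mulmx0. Qed.

(** A vanishing determinant gives a nonzero combination of the rows of [G] that is zero at three
    columns: a dependency supported on five indices. *)
Lemma det3_neq0 i j k : uniq [:: i; j; k] -> D i j k != 0.
Proof.
move=> ijk; rewrite -det3E; apply/det0P => -[y y0 yG].
have yG0 : y *m G = 0.
  apply: (dependency_support slack_pair (A := ~: [set x in [:: i; j; k]])).
  - exact: gale_dependency.
  - move=> l; rewrite !inE negbK => /or3P l_ijk.
    have zero c : (y *m G) 0 (tnth [tuple i; j; k] c) = 0.
      have := congr1 (fun M : 'rV_3 => M 0 c) yG; rewrite !mxE => E; rewrite -[RHS]E.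
      by apply: eq_bigr => r _; rewrite !mxE.
    case: l_ijk => /eqP->; first exact: (zero ord0).
      exact: (zero (lift ord0 ord0)).
    exact: (zero (lift ord0 (lift ord0 ord0))).
  - by rewrite cardsCs finset.setCK card_ord cardsE (card_uniqP ijk).
by case/eqP: y0; apply/(row_free_inj G_free); rewrite yG0 mul0mx.
Qed.

(** For the count: by [det3_row] the determinants with [i] and [j] form a dependency, so at least
    three are positive, and by exchanging [i] and [j] at least three are negative. Six other indices
    are left, so both numbers are 3. *)
Lemma chi_balanced : balanced chi.
Proof.
have neg i j k : uniq [:: i; j; k] -> (D i j k < 0) = ~~ (0 < D i j k).
  by move=> /det3_neq0 ijk; rewrite -leNgt lt_neqAle ijk.
have deg i j : D i j i = 0 by rewrite /det3; ring.
have deg2 i j : D i j j = 0 by rewrite /det3; ring.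
have three i j : i != j -> (2 < #|[set k | chi i j k]|)%N.
  move=> ij; have [y yE] := det3_row G i j.
  have -> : [set k | chi i j k] = [set k | (0 < (y *m G) 0 k)%R].
    by apply/finset.setP => k; rewrite !inE yE.
  apply: (dependency_card slack_pair (gale_dependency y)).
  have [|k] := @ord_notin _ [set i; j]; first by rewrite cards2 ij.
  rewrite !inE negb_or => /andP[ki kj].
  apply: contraTneq (det3_neq0 (_ : uniq [:: i; j; k])) => [yG0|].
    by rewrite -yE yG0 mxE eqxx.
  by rewrite /= !inE negb_or ij ![_ == k]eq_sym ki kj.
split=> [i j k|i j k ijk|i j|i j ij|a w x y z awxyz].
- by rewrite /chi det3_cyc.
- by rewrite /chi det3_anti oppr_gt0 neg.
- by rewrite /chi deg ltxx.
- have c1 := three i j ij; have c2 : (2 < #|[set k | chi j i k]|)%N.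
    by apply: three; rewrite eq_sym.
  have dis : [set k | chi i j k] :&: [set k | chi j i k] = finset.set0.
    by apply/finset.setP => k; rewrite !inE /chi det3_anti; apply/negP => /andP[]; lra.
  have : [set k | chi i j k] :|: [set k | chi j i k] \subset ~: [set i; j].
    apply/fintype.subsetP => k; rewrite !inE /chi det3_anti => kij.
    by apply/negP => /orP[]/eqP E; move: kij; rewrite E ?deg ?deg2 oppr0 ltxx.
  move=> /subset_leq_card; rewrite cardsU dis cards0 subn0.
  rewrite [in X in (_ <= X)%N -> _]cardsCs finset.setCK card_ord cards2 ij.
  by move: c1 c2; lia.
have := det3_gp G a w x y z.
have sgM (p q : R) : p != 0 -> q != 0 -> ((0 < p) == (0 < q)) = (0 < p * q).
  move=> p0 q0; have [p1|p1] := ltP 0 p.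
    by rewrite pmulr_rgt0.
  rewrite nmulr_rgt0; last by rewrite lt_neqAle p0.
  by rewrite [q < 0]lt_neqAle q0 leNgt; case: (0 < q).
have u p : p \in [:: (w, x); (y, z); (w, y); (x, z); (w, z); (x, y)] ->
    D a p.1 p.2 != 0.
  move=> pq; apply: det3_neq0; move: awxyz pq; rewrite /= !inE.
  by move=> awxyz; do 5?[case/orP]; move=> /eqP-> /=; move: awxyz;
    do !case: (_ == _) => //=.
have u1 := u (w, x); have u2 := u (y, z); have u3 := u (w, y).
have u4 := u (x, z); have u5 := u (w, z); have u6 := u (x, y).
move: u1 u2 u3 u4 u5 u6; rewrite !inE !eqxx ?orbT /= => u1 u2 u3 u4 u5 u6.
rewrite /chi (sgM _ _ (u1 isT) (u2 isT)) (sgM _ _ (u3 isT) (u4 isT)).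
rewrite (sgM _ _ (u5 isT) (u6 isT)).
have := mulf_neq0 (u1 isT) (u2 isT); have := mulf_neq0 (u3 isT) (u4 isT).
move: (_ * D a y z) (_ * D a x z) (_ * D a x y) => t1 t2 t3 t20 t10 E.
clear -E; have [t1p|t1n] := ltP 0 t1; have [t2p|t2n] := ltP 0 t2;
  have [t3p|t3n] := ltP 0 t3 => //=; exfalso; lra.
Qed.

(** By Cramer's rule the four signed determinants are the coefficients of a relation among columns
    of [G], hence a slack vector by [G_total]. The sign hypothesis makes them all positive or all
    negative, and [sg] corrects the sign. *)
Lemma positive_relation_point a b c d : uniq [:: a; b; c; d] ->
    pos_dependent chi a b c d ->
  exists v, (forall k, k \in [:: a; b; c; d] -> 0 < slack v k) /\
    (forall k, k \notin [:: a; b; c; d] -> slack v k = 0).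
Proof.
move=> abcd; rewrite /pos_dependent => /and3P[/eqP e1 /eqP e2 /eqP e3].
pose s : 'rV[R]_8 := D b c d *: delta_mx 0 a - D a c d *: delta_mx 0 b
  + D a b d *: delta_mx 0 c - D a b c *: delta_mx 0 d.
have [|v vE] := G_total (s := s).
  rewrite /s !(mulmxBl, mulmxDl) -!scalemxAl -!rowE; apply/rowP => r.
  by rewrite !mxE; apply: det3_relation.
have sE k : slack v k = D b c d * (k == a)%:R - D a c d * (k == b)%:R
    + D a b d * (k == c)%:R - D a b c * (k == d)%:R.
  by rewrite /slack -vE /s !mxE !eqxx.
have nz : [/\ D b c d != 0, D a c d != 0, D a b d != 0 & D a b c != 0].
  by split; apply: det3_neq0; move: abcd; rewrite /= !inE; do !case: (_ == _).
move: abcd; rewrite /= !inE !negb_or => /and4P[/and3P[ab ac ad] /andP[bc bd] cd _].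
have [ba ca da] : [/\ b != a, c != a & d != a] by rewrite !(eq_sym _ a).
have [cb db dc] : [/\ c != b, d != b & d != c] by rewrite !(eq_sym _ b) (eq_sym d).
have va : slack v a = D b c d.
  by rewrite sE eqxx (negPf ab) (negPf ac) (negPf ad); rewrite /= ?mulr0n ?mulr1n; ring.
have vb : slack v b = - D a c d.
  by rewrite sE eqxx (negPf ba) (negPf bc) (negPf bd); rewrite /= ?mulr0n ?mulr1n; ring.
have vc : slack v c = D a b d.
  by rewrite sE eqxx (negPf ca) (negPf cb) (negPf cd); rewrite /= ?mulr0n ?mulr1n; ring.
have vd : slack v d = - D a b c.
  by rewrite sE eqxx (negPf da) (negPf db) (negPf dc); rewrite /= ?mulr0n ?mulr1n; ring.
pose sg : R := if 0 < D b c d then 1 else -1.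
exists (sg *: v); split=> k; rewrite slackZ.
  rewrite !inE => /or4P[]/eqP->; rewrite ?va ?vb ?vc ?vd /sg;
    move: e1 e2 e3; rewrite /chi; case: nz; rewrite !neq_lt;
    case: (ltrP 0 (D b c d)); case: (ltrP 0 (D a c d)); case: (ltrP 0 (D a b d));
    case: (ltrP 0 (D a b c)) => //= ? ? ? ?; rewrite !orbF; lra.
rewrite !inE !negb_or => /and4P[ka kb kc kd].
by rewrite sE (negPf ka) (negPf kb) (negPf kc) (negPf kd); rewrite /= ?mulr0n ?mulr1n; ring.
Qed.

End BalancedGale.

(** * Chains of points on a quadric *)

Section NullChain.
Variables (R : realFieldType) (V : lmodType R) (B : V -> V -> R).
Hypothesis B_sym : forall u v, B u v = B v u.
Hypothesis B_add : forall u v w, B (u + v) w = B u w + B v w.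
Hypothesis B_scale : forall k u w, B (k *: u) w = k * B u w.

Lemma form_addr u v w : B w (u + v) = B w u + B w v.
Proof. by rewrite B_sym B_add !(B_sym w). Qed.

Lemma form_scaler k u w : B w (k *: u) = k * B w u.
Proof. by rewrite B_sym B_scale (B_sym w). Qed.

(* The equation depends on [x1 - x4] only, whose coordinates in [(d2, d3)] are
   [(y2 + eta * y4, y3 + theta * y4)], and it is linear in it. *)
Lemma null_chain (x1 x2 x3 x4 d2 d3 : V) (y2 y3 y4 eta theta : R) :
    y2 != 0 -> y3 != 0 -> y4 != 0 ->
    x2 = x1 - y2 *: d2 -> x3 = x2 - y3 *: d3 ->
    x4 = x3 - y4 *: (eta *: d2 + theta *: d3) ->
    B x1 x1 = 0 -> B x2 x2 = 0 -> B x3 x3 = 0 -> B x4 x4 = 0 ->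
  eta * (y2 + eta * y4) * B d2 d2
    + (y3 + theta * y4) * (2 * eta * B d2 d3 + theta * B d3 d3) = 0.
Proof.
move=> y20 y30 y40 -> -> ->; rewrite -!scaleNr.
rewrite !(B_add, form_addr, B_scale, form_scaler).
rewrite (B_sym d2 x1) (B_sym d3 x1) (B_sym d3 d2).
move: (B x1 x1) (B x1 d2) (B x1 d3) (B d2 d2) (B d2 d3) (B d3 d3).
move=> q b b' q22 q23 q33 -> E2 E3 E4.
(* Both [x1] and [x1 - y2 *: d2] are null, and the difference of the two equations is divisible by
   [y2]. *)
have e2 : 2 * b = y2 * q22.
  have : y2 * (2 * b - y2 * q22) = 0 by lra.
  by move=> /eqP; rewrite mulf_eq0 (negPf y20) subr_eq0 => /eqP.
have e3 : 2 * b' = 2 * y2 * q23 + y3 * q33.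
  have : y3 * (2 * b' - (2 * y2 * q23 + y3 * q33)) = 0 by lra.
  by move=> /eqP; rewrite mulf_eq0 (negPf y30) subr_eq0 => /eqP.
apply: (mulfI y40); rewrite mulr0.
have e2' : y4 * eta * (2 * b) = y4 * eta * (y2 * q22) by rewrite e2.
have e3' : y4 * theta * (2 * b') = y4 * theta * (2 * y2 * q23 + y3 * q33) by rewrite e3.
lra.
Qed.

End NullChain.

(** * A wedge whose eight vertices lie on a quadric *)

Section Wedge.
Variables (R : realFieldType) (N : 'M[R]_(5, 8)) (p : nat -> 'I_8).
Local Notation slack := (slack N).
Hypothesis slack_pair : forall i j, i != j ->
  exists v, [/\ slack v i = 0, slack v j = 0 &
    forall k, k != i -> k != j -> 0 < slack v k].
Hypothesis p_inj : {in [pred i | (i < 8)%N] &, injective p}.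
Variable B : 'rV[R]_5 -> 'rV[R]_5 -> R.
Hypothesis B_sym : forall u v, B u v = B v u.
Hypothesis B_add : forall u v w, B (u + v) w = B u w + B v w.
Hypothesis B_scale : forall k u w, B (k *: u) w = k * B u w.

Definition supported_on (v : 'rV[R]_5) (l : seq nat) :=
  (forall i, i \in l -> 0 < slack v (p i)) /\
  (forall i, (i < 8)%N -> i \notin l -> slack v (p i) = 0).

Lemma five_zeros (l : seq nat) v : size l == 5 -> uniq l ->
  all (fun i => i < 8)%N l -> all (fun i => slack v (p i) == 0) l -> v = 0.
Proof.
move=> l5 ul /allP l8 /allP lv; have pl5 : size (map p l) == 5 by rewrite size_map.
apply: (five_slacks slack_pair (t := Tuple pl5)) => /=.
  by rewrite map_inj_in_uniq // => i j /l8 i8 /l8 j8; apply: p_inj.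
by move=> _ /mapP[i /lv /eqP vi ->].
Qed.

(** The multiple of [w] that agrees with [u] at [j] differs from [u] by a vector with five zeros. *)
Lemma proportional (l : seq nat) j u w : size l == 4 -> uniq (j :: l) ->
    all (fun i => i < 8)%N (j :: l) ->
    all (fun i => (slack u (p i) == 0) && (slack w (p i) == 0)) l ->
    slack w (p j) != 0 ->
  u = (slack u (p j) / slack w (p j)) *: w.
Proof.
move=> l4 ul l8 /allP uw wj; apply/eqP; rewrite -subr_eq0; apply/eqP.
apply: (five_zeros (l := j :: l)) => //=; rewrite slackB slackZ divfK // subrr eqxx /=.
by apply/allP => i /uw /andP[/eqP ui /eqP wi]; rewrite slackB slackZ ui wi mulr0 subr0.
Qed.

(* Here [p] lists the facets F, A, B, c1, ..., c5. Any functional of the facets that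
   vanishes on F, A, B and c_i determines the point of the line F A B on c_i, up to
   scaling; [d2], [d3], [d4] represent these points for c2, c3, c4. *)
Lemma wedge_not_inscribed (a1 a2 a3 a4 b1 b2 b3 b4 : 'rV[R]_5) :
    supported_on a1 [:: 2; 5; 6; 7] -> supported_on a2 [:: 2; 3; 6; 7] ->
    supported_on a3 [:: 2; 3; 4; 7] -> supported_on a4 [:: 2; 3; 4; 5] ->
    supported_on b1 [:: 1; 5; 6; 7] -> supported_on b2 [:: 1; 3; 6; 7] ->
    supported_on b3 [:: 1; 3; 4; 7] -> supported_on b4 [:: 1; 3; 4; 5] ->
    {in [:: a1; a2; a3; a4], forall v, slack v (p 2) = 1} ->
    {in [:: b1; b2; b3; b4], forall v, slack v (p 1) = 1} ->
    {in [:: a1; a2; a3; a4; b1; b2; b3; b4], forall v, B v v = 0} ->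
  B a1 a2 != 0 -> False.
Proof.
move=> [a1P a1Z] [a2P a2Z] [a3P a3Z] [a4P a4Z] [b1P b1Z] [b2P b2Z] [b3P b3Z] [b4P b4Z].
move=> a_1 b_1 null a12.
have sB := @slackB R N; have sZ := @slackZ R N; have sD := @slackD R N.
have a1_1 : slack a1 (p 2) = 1 by apply: a_1; rewrite !inE eqxx.
have a2_1 : slack a2 (p 2) = 1 by apply: a_1; rewrite !inE eqxx ?orbT.
have a3_1 : slack a3 (p 2) = 1 by apply: a_1; rewrite !inE eqxx ?orbT.
have a4_1 : slack a4 (p 2) = 1 by apply: a_1; rewrite !inE eqxx ?orbT.
have b1_1 : slack b1 (p 1) = 1 by apply: b_1; rewrite !inE eqxx.
have b2_1 : slack b2 (p 1) = 1 by apply: b_1; rewrite !inE eqxx ?orbT.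
have b3_1 : slack b3 (p 1) = 1 by apply: b_1; rewrite !inE eqxx ?orbT.
have b4_1 : slack b4 (p 1) = 1 by apply: b_1; rewrite !inE eqxx ?orbT.
(* Consecutive [a]'s share the facets F, A and one [c_i]; as both have slack 1 on B, their
   difference vanishes on B too. For the [b]'s the roles of A and B are exchanged. *)
pose d2 := a1 - a2; pose d3 := a2 - a3; pose d4 := a3 - a4.
pose e2 := b1 - b2; pose e3 := b2 - b3; pose e4 := b3 - b4.
have d2_5 : slack d2 (p 5) != 0 by rewrite sB a2Z // subr0 gt_eqF ?a1P.
have e2_5 : slack e2 (p 5) != 0 by rewrite sB b2Z // subr0 gt_eqF ?b1P.
have d3_4 : slack d3 (p 4) != 0 by rewrite sB a2Z // sub0r oppr_eq0 gt_eqF ?a3P.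
have e3_4 : slack e3 (p 4) != 0 by rewrite sB b2Z // sub0r oppr_eq0 gt_eqF ?b3P.
have d4_5 : slack d4 (p 5) != 0 by rewrite sB a3Z // sub0r oppr_eq0 gt_eqF ?a4P.
have e4_5 : slack e4 (p 5) != 0 by rewrite sB b3Z // sub0r oppr_eq0 gt_eqF ?b4P.
have d2Z i : i \in [:: 0; 1; 2; 4]%N -> slack d2 (p i) = 0.
  rewrite !inE => /or4P[]/eqP->; rewrite sB ?a1_1 ?a2_1 ?subrr //;
  by rewrite a1Z // a2Z // subrr.
have d3Z i : i \in [:: 0; 1; 2; 5]%N -> slack d3 (p i) = 0.
  rewrite !inE => /or4P[]/eqP->; rewrite sB ?a2_1 ?a3_1 ?subrr //;
  by rewrite a2Z // a3Z // subrr.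
have d4Z i : i \in [:: 0; 1; 2; 6]%N -> slack d4 (p i) = 0.
  rewrite !inE => /or4P[]/eqP->; rewrite sB ?a3_1 ?a4_1 ?subrr //;
  by rewrite a3Z // a4Z // subrr.
have e2Z i : i \in [:: 0; 1; 2; 4]%N -> slack e2 (p i) = 0.
  rewrite !inE => /or4P[]/eqP->; rewrite sB ?b1_1 ?b2_1 ?subrr //;
  by rewrite b1Z // b2Z // subrr.
have e3Z i : i \in [:: 0; 1; 2; 5]%N -> slack e3 (p i) = 0.
  rewrite !inE => /or4P[]/eqP->; rewrite sB ?b2_1 ?b3_1 ?subrr //;
  by rewrite b2Z // b3Z // subrr.
have e4Z i : i \in [:: 0; 1; 2; 6]%N -> slack e4 (p i) = 0.
  rewrite !inE => /or4P[]/eqP->; rewrite sB ?b3_1 ?b4_1 ?subrr //;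
  by rewrite b3Z // b4Z // subrr.
pose eta := slack d4 (p 5) / slack d2 (p 5).
pose theta := slack d4 (p 4) / slack d3 (p 4).
pose y2 := slack e2 (p 5) / slack d2 (p 5).
pose y3 := slack e3 (p 4) / slack d3 (p 4).
pose y4 := slack e4 (p 5) / slack d4 (p 5).
have e2E : e2 = y2 *: d2.
  by apply: (proportional (l := [:: 0; 1; 2; 4])) => //=;
    rewrite !e2Z ?d2Z ?inE ?eqxx ?orbT.
have e3E : e3 = y3 *: d3.
  by apply: (proportional (l := [:: 0; 1; 2; 5])) => //=;
    rewrite !e3Z ?d3Z ?inE ?eqxx ?orbT.
have e4E : e4 = y4 *: d4.
  by apply: (proportional (l := [:: 0; 1; 2; 6])) => //=;
    rewrite !e4Z ?d4Z ?inE ?eqxx ?orbT.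
have d4E : d4 = eta *: d2 + theta *: d3.
  apply/eqP; rewrite -subr_eq0; apply/eqP/(five_zeros (l := [:: 0; 1; 2; 4; 5])) => //.
  apply/allP => i; rewrite !inE (sB d4) (sD (eta *: d2)) (sZ eta) (sZ theta).
  move=> /or3P[/eqP->|/eqP->|/or3P[]/eqP->].
  - by rewrite d2Z // d3Z // d4Z // !mulr0 addr0 subrr.
  - by rewrite d2Z // d3Z // d4Z // !mulr0 addr0 subrr.
  - by rewrite d2Z // d3Z // d4Z // !mulr0 addr0 subrr.
  - by rewrite d2Z // mulr0 add0r divfK // subrr.
  - by rewrite d3Z // mulr0 addr0 divfK // subrr.
have [y20 y30 y40] : [/\ y2 != 0, y3 != 0 & y4 != 0].
  by split; rewrite mulf_neq0 ?invr_eq0.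
have eta0 : eta != 0 by rewrite mulf_neq0 ?invr_eq0.
have nulls v : v \in [:: a1; a2; a3; a4; b1; b2; b3; b4] -> B v v = 0 by apply: null.
have eqA := null_chain B_sym B_add B_scale (x1 := a1) (x2 := a2) (x3 := a3) (x4 := a4)
  (d2 := d2) (d3 := d3) (y2 := 1) (y3 := 1) (y4 := 1) (eta := eta) (theta := theta)
  (oner_neq0 _) (oner_neq0 _) (oner_neq0 _).
have eqB := null_chain B_sym B_add B_scale (x1 := b1) (x2 := b2) (x3 := b3) (x4 := b4)
  (d2 := d2) (d3 := d3) (eta := eta) (theta := theta) y20 y30 y40.
rewrite -d4E !scale1r /d2 /d3 /d4 !subKr in eqA.
rewrite -d4E -e2E -e3E -e4E /e2 /e3 /e4 !subKr in eqB.
have {}eqA := eqA erefl erefl erefl; have {}eqB := eqB erefl erefl erefl.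
have [n1 n2 n3 n4] : [/\ B a1 a1 = 0, B a2 a2 = 0, B a3 a3 = 0 & B a4 a4 = 0].
  by split; apply: nulls; rewrite !inE eqxx ?orbT.
have [m1 m2 m3 m4] : [/\ B b1 b1 = 0, B b2 b2 = 0, B b3 b3 = 0 & B b4 b4 = 0].
  by split; apply: nulls; rewrite !inE eqxx ?orbT.
have {eqA n3 n4} := eqA n1 n2 n3 n4; have {eqB m1 m2 m3 m4} := eqB m1 m2 m3 m4.
rewrite -/d2 -/d3 !mulr1.
have q22 : B d2 d2 = - 2 * B a1 a2.
  rewrite /d2 -scaleN1r.
  rewrite !(B_add, form_addr B_sym B_add, B_scale, form_scaler B_sym B_scale).
  by rewrite (B_sym a2 a1) n1 n2; ring.
have Q0 : B d2 d2 != 0 by rewrite q22 mulf_neq0 // oppr_eq0 pnatr_eq0.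
move: (B d2 d2) (2 * eta * B d2 d3 + _) Q0 => Q l Q0 eqB eqA.
have a14 : a1 - a4 = (1 + eta) *: d2 + (1 + theta) *: d3.
  rewrite !scalerDl !scale1r addrACA -d4E.
  by rewrite /d2 /d3 /d4 !addrA !subrK.
have b14 : b1 - b4 = (y2 + eta * y4) *: d2 + (y3 + theta * y4) *: d3.
  have -> : b1 - b4 = e2 + e3 + e4 by rewrite /e2 /e3 /e4 !addrA !subrK.
  by rewrite e2E e3E e4E d4E; apply/rowP => i; rewrite !mxE; ring.
have kQ0 : eta * Q != 0 by rewrite mulf_neq0.
(* The displacements of the two chains satisfy the same linear equation in the coordinates along
   [d2] and [d3]. As [eta * Q] is nonzero, one coordinate determines the other, so [a1 - a4] and
   [b1 - b4] are proportional. *)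
have coef x y : eta * x * Q + y * l = 0 -> x = - (l / (eta * Q)) * y.
  move=> /eqP; rewrite addr_eq0 => /eqP E.
  rewrite mulNr mulrAC -mulNr; apply: (mulIf kQ0); rewrite divfK //.
  by rewrite mulrCA mulrA E mulrC.
have X3 : 1 + theta != 0.
  apply/eqP => X30; have := coef _ _ eqA; rewrite X30 mulr0 => X20.
  have : slack (a1 - a4) (p 6) = 0.
    by rewrite a14 X30 X20 !scale0r addr0 -(subrr d2) sB subrr.
  by rewrite sB a4Z // subr0 => /eqP; rewrite gt_eqF ?a1P.
have Y3 : y3 + theta * y4 != 0.
  apply/eqP => Y30; have := coef _ _ eqB; rewrite Y30 mulr0 => Y20.
  have : slack (b1 - b4) (p 6) = 0.
    by rewrite b14 Y30 Y20 !scale0r addr0 -(subrr d2) sB subrr.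
  by rewrite sB b4Z // subr0 => /eqP; rewrite gt_eqF ?b1P.
pose tau := (1 + theta) / (y3 + theta * y4).
have tauE : a1 - a4 = tau *: (b1 - b4).
  have t3 : 1 + theta = tau * (y3 + theta * y4) by rewrite divfK.
  have t2 : 1 + eta = tau * (y2 + eta * y4).
    by rewrite (coef _ _ eqA) (coef _ _ eqB) t3; ring.
  by rewrite a14 b14 t2 t3 -!(scalerA tau) -scalerDr.
(* This is the common point: the left side vanishes on F, c1, c2, and the right side on c4, c5. *)
have wE : a1 - tau *: b1 = a4 - tau *: b4.
  have -> : a1 = tau *: (b1 - b4) + a4 by rewrite -tauE subrK.
  by apply/rowP => i; rewrite !mxE; ring.
have w0 : a1 - tau *: b1 = 0.
  apply: (five_zeros (l := [:: 0; 3; 4; 6; 7])) => //; apply/allP => i.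
  rewrite !inE => /or3P[/eqP->|/eqP->|/or3P[]/eqP->].
  - by rewrite sB sZ a1Z // b1Z // mulr0 subrr.
  - by rewrite sB sZ a1Z // b1Z // mulr0 subrr.
  - by rewrite sB sZ a1Z // b1Z // mulr0 subrr.
  - by rewrite wE sB sZ a4Z // b4Z // mulr0 subrr.
  - by rewrite wE sB sZ a4Z // b4Z // mulr0 subrr.
have : slack (a1 - tau *: b1) (p 1) = 0 by rewrite w0 -(subrr d2) sB subrr.
rewrite sB sZ b1_1 mulr1 a1Z // sub0r => /eqP.
by rewrite oppr_eq0 mulf_eq0 invr_eq0 (negPf X3) (negPf Y3).
Qed.
End Wedge.

Local Open Scope classical_set_scope.

(** * Faces of polytopes *)

Section DotProduct.
Variables (R : realType) (n : nat).
Implicit Types (u v w : 'rV[R]_n) (k : R).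

Lemma dotC u v : dot u v = dot v u.
Proof. by apply: eq_bigr => i _; rewrite mulrC. Qed.

Lemma dotDr u v w : dot u (v + w) = dot u v + dot u w.
Proof. by rewrite -big_split; apply: eq_bigr => i _; rewrite mxE mulrDr. Qed.

Lemma dotZr k u v : dot u (k *: v) = k * dot u v.
Proof. by rewrite mulr_sumr; apply: eq_bigr => i _; rewrite mxE mulrCA. Qed.

Lemma dotNr u v : dot u (- v) = - dot u v.
Proof. by rewrite -scaleN1r dotZr mulN1r. Qed.

Lemma dotBr u v w : dot u (v - w) = dot u v - dot u w.
Proof. by rewrite dotDr dotNr. Qed.

Lemma dotDl u v w : dot (u + v) w = dot u w + dot v w.
Proof. by rewrite ![dot _ w]dotC dotDr. Qed.

Lemma dotZl k u v : dot (k *: u) v = k * dot u v.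
Proof. by rewrite ![dot _ v]dotC dotZr. Qed.

Lemma dotNl u v : dot (- u) v = - dot u v.
Proof. by rewrite ![dot _ v]dotC dotNr. Qed.

Lemma dotBl u v w : dot (u - v) w = dot u w - dot v w.
Proof. by rewrite dotDl dotNl. Qed.

Lemma dot0l u : dot 0 u = 0.
Proof. by rewrite -[0]subr0 dotBl subrr. Qed.

Lemma dot0r u : dot u 0 = 0.
Proof. by rewrite dotC dot0l. Qed.

Lemma dotvv_ge0 u : 0 <= dot u u.
Proof. by apply: sumr_ge0 => i _; rewrite -expr2 sqr_ge0. Qed.

Lemma dotvv_eq0 u : (dot u u == 0) = (u == 0).
Proof.
apply/idP/eqP => [|->]; last by rewrite dot0l eqxx.
rewrite /dot psumr_eq0 => [/allP u0|i _]; last by rewrite -expr2 sqr_ge0.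
apply/rowP => i; have := u0 i (mem_index_enum i).
by rewrite mulf_eq0 orbb mxE => /eqP.
Qed.

End DotProduct.

Lemma dot_row_mx (R : realType) (m n : nat) (u1 v1 : 'rV[R]_m)
    (u2 v2 : 'rV[R]_n) :
  dot (row_mx u1 u2) (row_mx v1 v2) = dot u1 v1 + dot u2 v2.
Proof.
by rewrite /dot big_split_ord; congr (_ + _); apply: eq_bigr => i _;
  rewrite ?row_mxEl ?row_mxEr.
Qed.

(** * Separation of points from cones and convex hulls *)

Section Separation.
Variables (R : realType).

Fixpoint in_cone (n : nat) (s : seq 'rV[R]_n) (y : 'rV[R]_n) : Prop :=
  if s is v :: s' then exists2 c : R, 0 <= c & in_cone s' (y - c *: v)
  else y = 0.

Lemma in_cone_ge0 n (s : seq 'rV[R]_n) a y :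
  (forall v, v \in s -> 0 <= dot a v) -> in_cone s y -> 0 <= dot a y.
Proof.
elim: s y => [|v s IH] y as_ /=; first by move->; rewrite dot0r.
move=> [c c0 /IH yc]; rewrite -(subrK (c *: v) y) dotDr dotZr.
rewrite addr_ge0 ?mulr_ge0 ?yc ?as_ ?inE ?eqxx // => w ws.
by rewrite as_ // inE ws orbT.
Qed.

(* If the functional [a] separating [y] from the cone of the first vectors is
   negative on the next vector [v], project along [v] onto [ker a]. *)
Lemma farkas n (s : seq 'rV[R]_n) y : ~ in_cone s y ->
  exists2 a, (forall v, v \in s -> 0 <= dot a v) & dot a y < 0.
Proof.
have [k] := ubnP (size s); elim: k s y => // k IH [|v s] y /= sk yNs.
  exists (- y) => //; rewrite dotNl oppr_lt0 lt_neqAle dotvv_ge0 andbT eq_sym.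
  by rewrite dotvv_eq0; apply/eqP.
have [|a as_ ay] := IH s y sk.
  by move=> ys; apply: yNs; exists 0 => //; rewrite scale0r subr0.
have [av|av] := leP 0 (dot a v).
  by exists a => // w; rewrite inE => /orP[/eqP-> //|]; apply: as_.
pose p w := w - (dot a w / dot a v) *: v.
have [||a' a's a'y] := IH [seq p w | w <- s] (p y).
- by rewrite size_map.
- have cone_p t z : in_cone [seq p w | w <- t] z ->
      exists c, in_cone t (z + c *: v).
    elim: t z => [|w t IHt] z /=; first by move->; exists 0; rewrite scale0r addr0.
    move=> [c c0 /IHt[d zt]]; exists (d + c * (dot a w / dot a v)), c => //.
    move: zt; rewrite /p scalerBr scalerA scalerDl; congr in_cone.
    by rewrite opprB !addrA; apply/rowP => i; rewrite !mxE; ring.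
  move=> /cone_p[c ys].
  have cv : dot a y - (dot a y / dot a v - c) * dot a v >= 0.
    rewrite -dotZr -dotBr (in_cone_ge0 as_) //.
    by move: ys; rewrite /p scalerBl opprB addrA addrAC.
  apply: yNs; exists (dot a y / dot a v - c); last first.
    by move: ys; rewrite /p scalerBl opprB addrA addrAC.
  have c_le0 : c <= 0.
    by move: cv; rewrite mulrBl divfK ?lt_eqF// opprB addrC subrK nmulr_lge0.
  by rewrite subr_ge0 (le_trans c_le0)// ltW// ltr_ndivlMr // mul0r.
have pE w : dot (a' - (dot a' v / dot a v) *: a) w = dot a' (p w).
  by rewrite /p dotBl dotZl dotBr dotZr; ring.
exists (a' - (dot a' v / dot a v) *: a) => [w|]; last by rewrite pE.
rewrite inE => /orP[/eqP->|ws]; last by rewrite pE a's ?map_f.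
by rewrite pE /p divff ?lt_eqF // scale1r subrr dot0r.
Qed.

End Separation.

Section Hull.
Variables (R : realType) (n : nat).
Implicit Types (V C : set 'rV[R]_n) (a x y : 'rV[R]_n) (b : R).

Lemma convex_setP C : convex_set C <->
  forall x y t, 0 <= t <= 1 -> C x -> C y -> C (t *: x + (1 - t) *: y).
Proof.
split=> [Cc x y t t01 Cx Cy|Cc x y l].
  have := Cc x y (Itv01 (andP t01).1 (andP t01).2); rewrite !inE; exact.
by rewrite !inE => Cx Cy; apply: Cc => //; apply/andP; split.
Qed.

Lemma hull_le V a b : (forall x, V x -> dot a x <= b) ->
  forall x, convex_hull V x -> dot a x <= b.
Proof.
move=> Vab; apply: (@smallest_sub _ _ _ [set x | dot a x <= b]) => //.
apply/convex_setP => x y t /andP[t0 t1] /= xab yab.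
rewrite dotDr !dotZr.
have := ler_wpM2l t0 xab; have /ler_wpM2l/(_ _ _ yab) : 0 <= 1 - t by lra.
lra.
Qed.

Lemma hull_eq V a b : (forall x, V x -> dot a x = b) ->
  forall x, convex_hull V x -> dot a x = b.
Proof.
move=> Vab x Vx; apply/eqP; rewrite eq_le; apply/andP; split.
  by apply: hull_le Vx => y /Vab->.
rewrite -lerN2 -dotNl; apply: hull_le Vx => y /Vab <-; by rewrite dotNl.
Qed.

Lemma sub_hull V : V `<=` convex_hull V.
Proof. exact: sub_gen_smallest. Qed.

Lemma in_cone_hull (s : seq 'rV[R]_n) (t : R) (z : 'rV[R]_n) :
    in_cone [seq row_mx 1%:M v | v <- s] (row_mx t%:M z : 'rV_(1 + n)) ->
  [/\ 0 <= t, t = 0 -> z = 0 & 0 < t -> convex_hull [set` s] (t^-1 *: z)].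
Proof.
(* The induction removes generators while the target must stay fixed, so the hull is replaced by any
   convex set containing [s]. *)
suff H (C : set 'rV[R]_n) : convex_set C -> (forall v, v \in s -> C v) ->
    in_cone [seq row_mx 1%:M v | v <- s] (row_mx t%:M z : 'rV_(1 + n)) ->
    [/\ 0 <= t, t = 0 -> z = 0 & 0 < t -> C (t^-1 *: z)].
  move=> sz; have convT : @convex_set R 'rV[R]_n [set: 'rV[R]_n] by exact/convex_setP.
  split => [||t0 C [Cc sC]].
  - by have [] := H _ convT (fun _ _ => I) sz.
  - by have [] := H _ convT (fun _ _ => I) sz.
  - by have [_ _] := H C Cc sC sz; exact.
move=> /convex_setP Cc.
elim: s t z => [|v s IH] t z sC /=.
  rewrite -(@row_mx0 _ 1 1 n) => /eq_row_mx[/matrixP/(_ 0 0)].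
  by rewrite !mxE eqxx mulr1n => -> ->; split => //; rewrite ltxx.
move=> [c c0]; rewrite scale_row_mx opp_row_mx add_row_mx.
rewrite scale_scalar_mx mulr1 -raddfB /= => /IH[|tc tc0 tcp].
  by move=> w ws; apply: sC; rewrite inE ws orbT.
split.
- by rewrite -(subrK c t) addr_ge0.
- move=> t0; have c00 : c = 0 by lra.
  by have := tc0; rewrite c00 t0 subrr scale0r subr0; apply.
move=> t0; have [tc_0|tcN0] := eqVneq (t - c) 0.
  have ct : c = t by lra.
  have -> : z = t *: v by apply/eqP; rewrite -subr_eq0 -{1}ct tc0.
  rewrite scalerA mulVf ?scale1r ?lt0r_neq0 //; exact/sC/mem_head.
have tc_gt0 : 0 < t - c by rewrite lt_def tcN0.
have -> : t^-1 *: z = (c / t) *: v + (1 - c / t) *: ((t - c)^-1 *: (z - c *: v)).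
  rewrite scalerA; apply/rowP => i; rewrite !mxE; field.
  by rewrite tcN0 lt0r_neq0.
apply: Cc; [|exact/sC/mem_head|exact: tcp].
by rewrite divr_ge0 ?(ltW t0) //= ler_pdivrMr // mul1r; lra.
Qed.

Lemma separation (s : seq 'rV[R]_n) y : ~ convex_hull [set` s] y ->
  exists a b, (forall v, v \in s -> dot a v <= b) /\ b < dot a y.
Proof.
move=> yNs; have /farkas[a' as_ ay] :
    ~ in_cone [seq row_mx 1%:M v | v <- s] (row_mx 1%:M y : 'rV_(1 + n)).
  by move=> /in_cone_hull[_ _ /(_ ltr01)]; rewrite invr1 scale1r.
pose a := - rsubmx a'; pose b := dot (lsubmx a') 1%:M.
exists a, b; split => [v vs|]; last first.
  by move: ay; rewrite -(hsubmxK a') dot_row_mx /a /b dotNl; lra.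
have := as_ _ (map_f (row_mx 1%:M) vs).
by rewrite -(hsubmxK a') dot_row_mx /a /b dotNl; lra.
Qed.

End Hull.

(** * Dimension through the span of differences *)

Section Direction.
Variables (R : realType) (n : nat).
Implicit Types (S T : set 'rV[R]_n) (U W : {vspace 'rV[R]_n}).

Definition diffs_in S W := forall x y, S x -> S y -> x - y \in W.

Lemma direction_exists S :
  exists U, diffs_in S U /\ forall W, diffs_in S W -> (U <= W)%VS.
Proof.
have ex_dim : exists k, `[< exists W, diffs_in S W /\ \dim W = k >].
  exists (\dim {: 'rV[R]_n}); apply/asboolP; exists fullv; split=> // x y _ _.
  exact: memvf.
have [k /asboolP[U [SU <-]] U_min] := ex_minnP ex_dim.
exists U; split=> // W SW; have SUW : diffs_in S (U :&: W)%VS.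
  by move=> x y Sx Sy; rewrite memv_cap SU ?SW.
suff /eqP <- : (U :&: W == U)%VS by apply: capvSr.
by rewrite eqEdim capvSl U_min //; apply/asboolP; exists (U :&: W)%VS.
Qed.

Definition direction S : {vspace 'rV[R]_n} := sval (cid (direction_exists S)).

Lemma direction_diffs S : diffs_in S (direction S).
Proof. by rewrite /direction; case: cid => U [/=]. Qed.

Lemma direction_min S W : diffs_in S W -> (direction S <= W)%VS.
Proof. by rewrite /direction; case: cid => U [/= _]; apply. Qed.

Lemma direction_sub S T : S `<=` T -> (direction S <= direction T)%VS.
Proof.
by move=> ST; apply: direction_min => x y /ST Tx /ST; apply: direction_diffs.
Qed.

(** The affine hull of [S] is [x0 + direction S] for each [x0] in [S], and a flat determines its
    space of directions. *)
Lemma has_dimP S k : has_dim S k <-> S !=set0 /\ \dim (direction S) = k.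
Proof.
have hullE x0 : S x0 -> affine_hull S = flat x0 (direction S).
  move=> Sx0; apply/seteqP; split.
    apply: smallest_sub; first by exists x0, (direction S).
    move=> x Sx; exists (x - x0); last by rewrite addrC subrK.
    exact: direction_diffs.
  move=> _ [d dS <-] A [[x [U ->]] SU].
  have SUd : diffs_in S U.
    move=> y z /SU[u uU <-] /SU[v vU <-].
    by rewrite opprD addrACA subrr add0r memvB.
  have [u uU <-] := SU _ Sx0; exists (u + d); last by rewrite addrA.
  by apply: memvD => //; apply: subvP dS; apply: direction_min.
split=> [[[x0 Sx0] [x [U []]]]|[[x0 Sx0] <-]]; last first.
  by split; [exists x0|exists x0, (direction S); split => //; apply: hullE].
rewrite (hullE _ Sx0) => SxU <-; split; first by exists x0.
congr (\dim _); apply/eqP; rewrite eqEsubv; apply/andP; split; apply/subvP => u uU.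
  have [v vU vE] : flat x U (x0 + u) by rewrite -SxU; exists u.
  have [w wU wE] : flat x U x0.
    by rewrite -SxU; exists 0; rewrite ?addr0 //=; exact: mem0v.
  have -> : u = v - w by apply: (addrI x0); rewrite -vE -{1}wE addrACA subrr addr0.
  exact: memvB.
have [w wU wE] : flat x0 (direction S) (x + 0).
  by rewrite SxU; exists 0 => //; exact: mem0v.
have [v vU vE] : flat x0 (direction S) (x + u) by rewrite SxU; exists u.
have -> : u = v - w.
  by apply: (addrI x); rewrite -vE -[x]addr0 -wE addrACA subrr addr0.
exact: memvB.
Qed.

End Direction.

Section LinearAlgebra.
Variables (R : realType) (n : nat).
Implicit Types (U W : {vspace 'rV[R]_n}) (a x w : 'rV[R]_n).

Definition dot_fun a : 'rV[R]_n -> R^o := dot a.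

Lemma dot_fun_linear a : linear (dot_fun a).
Proof. by move=> k u v; rewrite /dot_fun dotDr dotZr. Qed.

HB.instance Definition _ a :=
  GRing.isLinear.Build R _ _ _ (dot_fun a) (dot_fun_linear a).

Definition orth a : {vspace 'rV[R]_n} := lker (linfun (dot_fun a)).

Lemma mem_orth a x : (x \in orth a) = (dot a x == 0).
Proof. by rewrite memv_ker lfunE. Qed.

Lemma dim_cap_orth W a : (\dim W <= (\dim (W :&: orth a)).+1)%N.
Proof.
rewrite -(limg_ker_dim (linfun (dot_fun a)) W) -[leqRHS]addn1 leq_add2l.
by rewrite (leq_trans (dimvS (subvf _))) // dimvf.
Qed.

(** The functional [c] is a coordinate of the residue [x - projv U x], one that is nonzero at
    [w]. *)
Lemma functional_notin U w : w \notin U ->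
  exists2 c, (forall u, u \in U -> dot c u = 0) & dot c w != 0.
Proof.
move=> wU; pose p x := x - projv U x.
have [i pwi] : exists i, p w 0 i != 0.
  apply/existsP; apply: contraR wU; rewrite negb_exists => /forallP pw0.
  rewrite (_ : w = projv U w) ?memv_proj //; apply/eqP; rewrite -subr_eq0.
  by apply/eqP/rowP => i; have := pw0 i; rewrite negbK [RHS]mxE => /eqP.
pose c : 'rV[R]_n := \row_j p (delta_mx 0 j) 0 i.
have cE x : dot c x = p x 0 i.
  rewrite {2}[x]row_sum_delta /p linear_sum -sumrB summxE.
  by apply: eq_bigr => j _; rewrite linearZ !mxE /=; ring.
exists c => [u uU|]; first by rewrite cE /p projv_id // subrr mxE.
by rewrite cE; move: pwi; rewrite mxE.
Qed.

End LinearAlgebra.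

Lemma seq_argmax (T : eqType) (R : realType) (f : T -> R) (s : seq T) x :
  x \in s -> exists2 y, y \in s & forall z, z \in s -> f z <= f y.
Proof.
elim: s x => // y [|z s] IH x _.
  by exists y; [exact: mem_head|move=> z; rewrite inE => /eqP->].
have [w ws wmax] := IH z (mem_head _ _).
have [yw|wy] := leP (f y) (f w).
  exists w => [|t]; first by rewrite inE ws orbT.
  by rewrite inE => /orP[/eqP-> //|/wmax].
exists y => [|t]; first exact: mem_head.
by rewrite inE => /orP[/eqP-> //|/wmax/le_trans-> //]; rewrite ltW.
Qed.

(** * Faces, and rotation of a supporting hyperplane around a face *)

Section Faces.
Variables (R : realType) (n : nat).
Implicit Types (P F G T : set 'rV[R]_n) (a c x y : 'rV[R]_n) (b : R).

Definition valid P a b := forall x, P x -> dot a x <= b.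

Definition face P a b := P `&` [set x | dot a x = b].

Lemma is_face_sub P F : is_face P F -> F `<=` P.
Proof. by move=> [a [b [_ ->]]] x []. Qed.

Lemma is_faceT P : is_face P P.
Proof.
exists 0, 0; split=> [x _|]; first by rewrite dot0l.
by apply/seteqP; split=> x; [move=> ?; split => //=; rewrite dot0l|case].
Qed.

Lemma is_faceI P F G : is_face P F -> is_face P G -> is_face P (F `&` G).
Proof.
move=> [a [b [Pab ->]]] [c [d [Pcd ->]]]; exists (a + c), (b + d); split.
  by move=> x Px; rewrite dotDl lerD ?Pab ?Pcd.
apply/seteqP; split=> x /=; first by move=> [[Px ax] [_ cx]]; rewrite dotDl ax cx.
move=> [Px]; rewrite dotDl => acx; have := Pab x Px; have := Pcd x Px.
by move=> ? ?; split; split => //=; lra.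
Qed.

(** The functional that cuts out [F] is constant on [F], so it kills the directions of [F], which
    are all those of [T]. *)
Lemma face_eq_of_dim P F T : is_face P F -> F !=set0 -> F `<=` T -> T `<=` P ->
  (\dim (direction T) <= \dim (direction F))%N -> F = T.
Proof.
move=> [a [b [Pab FE]]] [x0 Fx0] FT TP dimTF.
apply/seteqP; split=> // x Tx; rewrite FE; split; first exact: TP.
have /eqP dirE : direction F == direction T by rewrite eqEdim direction_sub.
have /subvP : (direction F <= orth a)%VS.
  apply: direction_min => y z; rewrite FE => -[_ /= ay] [_ /= az].
  by rewrite mem_orth dotBr ay az subrr.
move=> /(_ (x - x0)); rewrite dirE mem_orth dotBr.
move=> /(_ (direction_diffs Tx (FT _ Fx0))); rewrite subr_eq0 => /eqP/= ->.
by move: Fx0; rewrite FE => -[].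
Qed.

Lemma proper_face_dim P F : is_face P F -> F !=set0 -> F <> P ->
  (\dim (direction F) < \dim (direction P))%N.
Proof.
move=> fF F0 FP; rewrite ltnNge; apply/negP => dimPF; apply: FP.
exact: (face_eq_of_dim fF F0 (is_face_sub fF)).
Qed.

Section Polytope.
Variables (s : seq 'rV[R]_n).
Local Notation P := (convex_hull [set` s]).

Lemma valid_hull a b : (forall v, v \in s -> dot a v <= b) -> valid P a b.
Proof. exact: hull_le. Qed.

(* With [t] an affine function vanishing on the face [b - dot a x = 0], the two
   new functionals come from the extreme values of the slope [t / (b - dot a x)]
   over the generators. *)
Lemma rotate_face a b : valid P a b -> face P a b !=set0 ->
    ((\dim (direction (face P a b))).+2 <= \dim (direction P))%N ->
  exists (a1 : 'rV[R]_n) (b1 : R) (a2 : 'rV[R]_n) (b2 m : R),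
  [/\ 0 < m, forall x, b1 - dot a1 x + (b2 - dot a2 x) = m * (b - dot a x),
    [/\ valid P a1 b1, face P a b `<` face P a1 b1 & face P a1 b1 <> P] &
    [/\ valid P a2 b2, face P a b `<` face P a2 b2 & face P a2 b2 <> P]].
Proof.
set G := face P a b; move=> Pab [x0 Gx0] dimG.
have [Px0 /= ax0] := Gx0.
(* Intersecting with [orth a] lowers the dimension of the directions of [P] by at most one; the gap
   of two leaves a direction outside those of [G]. *)
have [w wP [aw wG]] : exists2 w, w \in direction P &
    dot a w = 0 /\ w \notin direction G.
  apply: contrapT => noW; move: dimG; apply/negP; rewrite -ltnNge.
  rewrite ltnS (leq_trans (dim_cap_orth _ a)) // ltnS dimvS //.
  apply/subvP => w; rewrite memv_cap mem_orth => /andP[wP /eqP aw].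
  by apply: contra_notT noW => wG; exists w.
have [c cG cw] := functional_notin wG.
pose t x := dot c (x - x0); pose sl x := b - dot a x.
have t0 x : G x -> t x = 0 by move=> Gx; apply/cG/direction_diffs.
have sl_ge0 v : v \in s -> 0 <= sl v.
  by move=> vs; rewrite subr_ge0 Pab //; apply: sub_hull.
have t_sl0 v : v \in s -> sl v = 0 -> t v = 0.
  move=> vs /eqP; rewrite subr_eq0 => /eqP bE; apply: t0.
  by split; [apply: sub_hull|].
(* If the slope were constant, [c + m *: a] would be constant on [P], but it is nonzero along
   [w]. *)
have notprop m : ~ forall v, v \in s -> t v = m * sl v.
  move=> tE; have {}tE x : P x -> dot (c + m *: a) x = m * b + dot c x0.
    apply: hull_eq => v /tE; rewrite /t /sl dotDl dotZl dotBr; lra.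
  have /subvP/(_ w wP) : (direction P <= orth (c + m *: a))%VS.
    by apply: direction_min => x y Px Py; rewrite mem_orth dotBr !tE // subrr.
  by rewrite mem_orth dotDl dotZl aw mulr0 addr0 (negPf cw).
pose s' := [seq v <- s | 0 < sl v].
have [v0 v0s] : exists v, v \in s'.
  have [/eqP s'0|] := boolP (s' == [::]); last first.
    by case: s' => // v s'' _; exists v; apply: mem_head.
  case: (notprop 0) => v vs; rewrite mul0r; apply: t_sl0 => //.
  apply/eqP; rewrite eq_le sl_ge0 // andbT leNgt; apply/negP => slv.
  by have : v \in s' by [rewrite mem_filter slv]; rewrite s'0.
have [v1 v1s v1max] := seq_argmax (fun v => t v / sl v) v0s.
have [v2 v2s v2min] := seq_argmax (fun v => - (t v / sl v)) v0s.
pose m1 := t v1 / sl v1; pose m2 := t v2 / sl v2.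
have s'P v : v \in s' -> v \in s /\ 0 < sl v by rewrite mem_filter => /andP[].
have [v1s_ slv1] := s'P _ v1s; have [v2s_ slv2] := s'P _ v2s.
have le1 v : v \in s -> t v <= m1 * sl v.
  move=> vs; have [slv|] := ltP 0 (sl v).
    by rewrite -ler_pdivrMr // v1max // mem_filter slv.
  move=> slv; have slv0 : sl v = 0 by apply/le_anti; rewrite slv sl_ge0.
  by rewrite slv0 t_sl0 // mulr0.
have le2 v : v \in s -> m2 * sl v <= t v.
  move=> vs; have [slv|] := ltP 0 (sl v).
    by rewrite -ler_pdivlMr // -lerN2 v2min // mem_filter slv.
  move=> slv; have slv0 : sl v = 0 by apply/le_anti; rewrite slv sl_ge0.
  by rewrite slv0 t_sl0 // mulr0.
have m21 : m2 < m1.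
  rewrite ltNge; apply/negP => m12; apply: (notprop m1) => v vs.
  apply/le_anti; rewrite le1 //=; apply: le_trans (le2 v vs).
  by rewrite ler_wpM2r ?sl_ge0.
have tv1 : t v1 = m1 * sl v1 by rewrite divfK ?gt_eqF.
have tv2 : t v2 = m2 * sl v2 by rewrite divfK ?gt_eqF.
(* The two new slacks are [m1 * sl - t] and [t - m2 * sl], with sum [(m1 - m2) * sl]. *)
exists (m1 *: a + c), (m1 * b + dot c x0).
exists (- (m2 *: a) - c), (- (m2 * b) - dot c x0), (m1 - m2).
have f1E x : m1 * b + dot c x0 - dot (m1 *: a + c) x = m1 * sl x - t x.
  by rewrite /sl /t dotDl dotZl dotBr; ring.
have f2E x : - (m2 * b) - dot c x0 - dot (- (m2 *: a) - c) x = t x - m2 * sl x.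
  by rewrite /sl /t dotBl dotNl dotZl dotBr; ring.
have P1 v : v \in s -> P v := @sub_hull _ _ [set` s] v.
split.
- by rewrite subr_gt0.
- by move=> x; rewrite f1E f2E /sl; ring.
- split.
  + by apply: valid_hull => v vs; rewrite -subr_ge0 f1E subr_ge0 le1.
  + split=> [x Gx|].
      split; first by case: Gx.
      apply/eqP; rewrite eq_sym -subr_eq0 f1E t0 // /sl.
      by case: Gx => _ /= ->; rewrite subrr mulr0 subr0.
    move=> /(_ v1)[]; first split; first exact: P1.
      by apply/eqP; rewrite eq_sym -subr_eq0 f1E tv1 subrr.
    by move=> _ /= av1; move: slv1; rewrite /sl av1 subrr ltxx.
  + move=> /seteqP[_ /(_ v2 (P1 _ v2s_))[_ /= /eqP]].
    rewrite eq_sym -subr_eq0 f1E tv2 -mulrBl mulf_eq0 gt_eqF ?subr_gt0 //=.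
    by rewrite gt_eqF.
- split.
  + by apply: valid_hull => v vs; rewrite -subr_ge0 f2E subr_ge0 le2.
  + split=> [x Gx|].
      split; first by case: Gx.
      apply/eqP; rewrite eq_sym -subr_eq0 f2E t0 // /sl.
      by case: Gx => _ /= ->; rewrite subrr mulr0 subr0.
    move=> /(_ v2)[]; first split; first exact: P1.
      by apply/eqP; rewrite eq_sym -subr_eq0 f2E tv2 subrr.
    by move=> _ /= av2; move: slv2; rewrite /sl av2 subrr ltxx.
  + move=> /seteqP[_ /(_ v1 (P1 _ v1s_))[_ /= /eqP]].
    rewrite eq_sym -subr_eq0 f2E tv1 -mulrBl mulf_eq0 gt_eqF ?subr_gt0 //=.
    by rewrite gt_eqF.
Qed.

(** By [rotate_face] a positive multiple of the slack of a face is the sum of the slacks of two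
    larger faces. If it is negative at [y], so is one of these two, and the climb continues with
    that face up to codimension one. *)
Lemma facet_above a b y : valid P a b -> face P a b !=set0 -> face P a b <> P ->
  exists a' b', [/\ valid P a' b', face P a b `<=` face P a' b',
    face P a' b' <> P,
    (\dim (direction (face P a' b'))).+1 = \dim (direction P) &
    b < dot a y -> b' < dot a' y].
Proof.
have [k] := ubnP (\dim (direction P) - \dim (direction (face P a b))).
elim: k a b => // k IH a b dimk Pab G0 GP.
have fG : is_face P (face P a b) by exists a, b.
have dimG := proper_face_dim fG G0 GP.
have [dimG2|dimG2] := leqP (\dim (direction (face P a b))).+2 (\dim (direction P)).
  have [a1 [b1 [a2 [b2 [m [m0 sumE [P1 [G1 G1'] F1] [P2 [G2 G2'] F2]]]]]]] :=
    rotate_face Pab G0 dimG2.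
  have step c d : valid P c d -> face P a b `<=` face P c d ->
      ~ (face P c d `<=` face P a b) -> face P c d <> P ->
      (b < dot a y -> d < dot c y) ->
      exists a' b', [/\ valid P a' b', face P a b `<=` face P a' b',
        face P a' b' <> P,
        (\dim (direction (face P a' b'))).+1 = \dim (direction P) &
        b < dot a y -> b' < dot a' y].
    move=> Pcd Gcd Gcd' FP cdy; have F0 : face P c d !=set0.
      by have [x /Gcd] := G0; exists x.
    have [|a' [b' [? cd' ? ? y']]] := IH c d _ Pcd F0 FP.
      rewrite -ltnS (leq_trans _ dimk) // ltnS; apply: ltn_sub2l => //.
      rewrite ltnNge; apply: contra_notN Gcd' => dimF.
      suff -> : face P a b = face P c d by [].
      by apply: (face_eq_of_dim fG G0 Gcd _ dimF) => x [].
    by exists a', b'; split => // [x /Gcd /cd' //|/cdy].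
  have [yb|y1|y2] : [\/ dot a y <= b, b1 < dot a1 y | b2 < dot a2 y].
  - have [yb|yb] := leP (dot a y) b; first exact: Or31.
    have [y1|y1] := ltP b1 (dot a1 y); first exact: Or32.
    apply: Or33; have := sumE y.
    by have : m * (b - dot a y) < 0; [rewrite pmulr_rlt0 // subr_lt0|lra].
  - by apply: (step a1 b1) => //; rewrite ltNge yb.
  - exact: (step a1 b1).
  - exact: (step a2 b2).
by exists a, b; split => //; lia.
Qed.

End Polytope.
End Faces.

(** * Ridges as intersections of pairs of facets *)

Section Neighborly.
Variables (R : realType) (n : nat).
Implicit Types (P F G : set 'rV[R]_n).

Lemma ridge_meet (s : seq 'rV[R]_n) G k : let P := convex_hull [set` s] in
  is_face P G -> has_dim G k -> \dim (direction P) = k.+2 ->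
  exists F1 F2, [/\ is_face P F1 /\ has_dim F1 k.+1,
    is_face P F2 /\ has_dim F2 k.+1, F1 <> F2 & G = F1 `&` F2].
Proof.
move=> P fG /has_dimP[G0 dimG] dimP; have [a [b [Pab GE]]] := fG.
rewrite -/(face P a b) in GE.
have Gab0 : face P a b !=set0 by rewrite -GE.
have [|a1 [b1 [a2 [b2 [m [m0 sumE F1 F2]]]]]] := rotate_face Pab Gab0.
  by rewrite -GE dimG dimP.
have dimF c d : [/\ valid P c d, face P a b `<` face P c d & face P c d <> P] ->
    is_face P (face P c d) /\ has_dim (face P c d) k.+1.
  move=> [Pcd [sub nsub] FP]; have fF : is_face P (face P c d) by exists c, d.
  have F0 : face P c d !=set0 by have [x /sub] := Gab0; exists x.
  split=> //; apply/has_dimP; split=> //; apply/eqP.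
  have := proper_face_dim fF F0 FP; rewrite dimP ltnS eqn_leq => -> /=.
  rewrite -dimG ltnNge; apply: contra_notN nsub => dimFG.
  suff -> : face P c d = face P a b by [].
  rewrite -GE; apply/esym; apply: (face_eq_of_dim fG G0 _ _ dimFG).
    by rewrite GE.
  by move=> x [].
have meetE : G = face P a1 b1 `&` face P a2 b2.
  rewrite GE; apply/seteqP; split=> [x Gx|x [[Px /= x1] [_ /= x2]]].
    by have [_ [s1 _] _] := F1; have [_ [s2 _] _] := F2; split; auto.
  split=> //=; apply/eqP; rewrite eq_sym -subr_eq0.
  by have /eqP := sumE x; rewrite x1 x2 !subrr addr0 eq_sym mulf_eq0 gt_eqF.
exists (face P a1 b1), (face P a2 b2); split; [exact: dimF|exact: dimF| |] => //.
move=> F12; have [_ [_ nsub] _] := F1; apply: nsub.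
by rewrite -GE meetE F12 => x.
Qed.

(** A ridge is determined by a pair of facets meeting in it, so ridges inject into pairs; the
    numbers agree, hence every pair occurs. If the meet of [F i] and [F j] lay in [F k], the ridges
    of [i, j] and of [i, k] would coincide by dimension. *)
Lemma neighborly_facets P : dpolytope 4 P ->
    (faces_of_dim P 2 #= `I_28)%card -> (faces_of_dim P 3 #= `I_8)%card ->
  exists F : 'I_8 -> set 'rV[R]_n,
  [/\ forall j, is_face P (F j), forall j, F j <> P,
    forall G, is_face P G -> G <> P -> exists j, G `<=` F j &
    forall i j k, i != j -> i != k -> j != k -> ~ F i `&` F j `<=` F k].
Proof.
move=> [[V [/finite_seqP[s ->]]] PE] /has_dimP[P0 dimP].
move=> /card_esym/card_set_bijP[r [r2 r_inj r_surj]].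
move=> /card_esym/card_set_bijP[f [f3 f_inj f_surj]].
pose F (j : 'I_8) := f j; pose ridge (j : 'I_28) := r j.
have F3 j : is_face P (F j) /\ has_dim (F j) 3 by apply: f3 => /=.
have ridge2 j : is_face P (ridge j) /\ has_dim (ridge j) 2 by apply: r2 => /=.
have F_surj G : is_face P G -> has_dim G 3 -> exists j, F j = G.
  by move=> fG dG; have [j /= j8 <-] := f_surj G (conj fG dG); exists (Ordinal j8).
have ridge_inj : injective ridge.
  by move=> i j ij; apply: val_inj; apply: r_inj ij; apply/mem_set => /=.
have capE (i j : 'I_8) : \bigcap_(k in [set` (i |: [set j])%SET]) F k = F i `&` F j.
  apply/seteqP; split=> x.
    by move=> xF; split; apply: xF; rewrite /= !inE eqxx ?orbT.
  by move=> [xi xj] k /=; rewrite !inE => /orP[]/eqP->.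
have /choice[phi phiP] (i : 'I_28) : exists A : {set 'I_8},
    #|A| = 2 /\ ridge i = \bigcap_(j in [set` A]) F j.
  have [fr dr] := ridge2 i; rewrite PE in fr dimP.
  have [F1 [F2 [[f1 d1] [f2 d2] F12 E]]] := ridge_meet fr dr dimP.
  rewrite -PE in f1 f2.
  have [j jE] := F_surj _ f1 d1; have [k kE] := F_surj _ f2 d2.
  exists (j |: [set k])%SET; rewrite capE jE kE; split => //.
  by rewrite cards2; case: eqVneq jE => // ->; rewrite kE => /esym.
have phi_inj : injective phi.
  move=> i j ij; apply: ridge_inj.
  by rewrite (phiP i).2 (phiP j).2 ij.
have phi_surj (i j : 'I_8) : i != j -> exists k, phi k = (i |: [set j])%SET.
  move=> ij.
  have /eqP imE :
      phi @: [set: 'I_28]%SET == [set A : {set 'I_8} | #|A| == 2]%SET.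
    rewrite eqEcard card_imset // cardsT card_ord card_draws card_ord.
    by apply/andP; split => //; apply/fintype.subsetP => _ /imsetP[k _ ->];
      rewrite inE (phiP k).1.
  have : (i |: [set j])%SET \in phi @: [set: 'I_28]%SET by rewrite imE inE cards2 ij.
  by move=> /imsetP[k _ kE]; exists k.
exists F; split => [j|j FP|G fG GP|i j k ij ik jk Fijk].
- exact: (F3 j).1.
- have [_ /has_dimP[_]] := F3 j; by rewrite FP dimP.
- have [[x Gx]|G0] := pselect (G !=set0); last first.
    by exists ord0 => x Gx; case: G0; exists x.
  have [a [b [Pab GE]]] := fG; rewrite -/(face P a b) in GE.
  have G0 : face P a b !=set0 by exists x; rewrite -GE.
  rewrite GE PE in Pab G0 GP *.
  have [a' [b' [Pab' sub F'P dimF' _]]] := facet_above 0 Pab G0 GP.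
  have [||j jE] := F_surj (face P a' b').
  + by exists a', b'; rewrite PE.
  + rewrite PE; apply/has_dimP; split; first by have [y /sub] := G0; exists y.
    by apply/eqP; rewrite -eqSS dimF' -PE dimP.
  + by exists j; rewrite jE PE.
- have [p pE] := phi_surj _ _ ij; have [q qE] := phi_surj _ _ ik.
  have [_ rp] := phiP p; have [_ rq] := phiP q.
  rewrite pE capE in rp; rewrite qE capE in rq.
  have [fp /has_dimP[p0 dp]] := ridge2 p; have [fq /has_dimP[_ dq]] := ridge2 q.
  have pq : ridge p = ridge q.
    apply: (face_eq_of_dim fp p0); last by rewrite dp dq.
      by rewrite rp rq => x Fx; split; [case: Fx|apply: Fijk].
    exact: is_face_sub fq.
  have : j \in phi q by rewrite -(ridge_inj _ _ pq) pE !inE eqxx orbT.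
  by rewrite qE !inE eq_sym (negPf ij) (negPf jk).
Qed.

End Neighborly.

(** Dimensions are left out: inclusions of faces alone pass through an isomorphism of face
    lattices. *)
Definition neighborly_cover (R : realType) (n N : nat) (P : set 'rV[R]_n)
    (F : 'I_N -> set 'rV[R]_n) : Prop :=
  [/\ forall j, is_face P (F j), forall j, F j <> P,
    forall G, is_face P G -> G <> P -> exists j, G `<=` F j &
    forall i j k, i != j -> i != k -> j != k -> ~ F i `&` F j `<=` F k].

Lemma neighborly_cover_comb_equiv (R : realType) (m n N : nat)
    (P : set 'rV[R]_m) (Q : set 'rV[R]_n) (F : 'I_N -> set 'rV[R]_m) :
  comb_equiv P Q -> neighborly_cover P F ->
  exists G : 'I_N -> set 'rV[R]_n, neighborly_cover Q G.
Proof.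
move=> [h [hf h_inj h_surj] hle] [fF FP Fcov Fneigh].
have hP : h P = Q.
  apply/seteqP; split; first exact: is_face_sub (hf _ (is_faceT P)).
  have [K fK <-] := h_surj _ (is_faceT Q).
  by apply/(hle _ _ fK (is_faceT P)); apply: is_face_sub.
exists (h \o F); split=> [j|j|G fG GQ|i j k ij ik jk] /=.
- exact/hf/fF.
- move=> hFQ; apply: (FP j); apply: h_inj; rewrite ?inE //.
  + exact: fF.
  + exact: is_faceT.
  + by rewrite hFQ hP.
- have [K fK KG] := h_surj _ fG.
  have [|j Kj] := Fcov K fK; first by move=> KP; apply: GQ; rewrite -KG KP hP.
  by exists j; rewrite -KG; apply/(hle _ _ fK (fF j)).
(* Monotonicity places [h] of the intersection inside both images. *)
- move=> hFijk; apply: (Fneigh i j k ij ik jk).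
  have fFij : is_face P (F i `&` F j) := is_faceI (fF i) (fF j).
  apply/(hle _ _ fFij (fF k)) => x hx; apply: hFijk; split.
    by move: x hx; apply/(hle _ _ fFij (fF i)) => y [].
  by move: x hx; apply/(hle _ _ fFij (fF j)) => y [].
Qed.

(** * Inequalities coming from the facets *)

Section HRepresentation.
Variables (R : realType) (n : nat).

(** Modulo the directions of the facet, [x - x0] is [k] times [q - x0] with [k >= 0] and [q] a point
    of [Q] off the facet. Both functionals kill these directions, so the slack for [a'] at [x] is
    [k] times that at [q]. *)
Lemma facet_functional_sign (Q : set 'rV[R]_n) a b a' b' x :
    dpolytope n Q -> valid Q a b -> valid Q a' b' -> face Q a b = face Q a' b' ->
    face Q a b !=set0 -> face Q a b <> Q ->
    (\dim (direction (face Q a b))).+1 = n ->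
  dot a x <= b -> dot a' x <= b'.
Proof.
move=> [_ /has_dimP[_ dimQ]] Qab Qab' FE [x0 Fx0] FQ dimF xab.
have [q Qq aq] : exists2 q, Q q & dot a q < b.
  apply: contrapT => noq; apply: FQ; apply/seteqP; split=> [y [] //|y Qy].
  split=> //=; apply/eqP; rewrite eq_le Qab //= leNgt; apply/negP => ay.
  by apply: noq; exists y.
have [Qx0 /= ax0] := Fx0; have [_ /= ax0'] : face Q a' b' x0 by rewrite -FE.
have /eqP dirE : direction (face Q a b) == orth a.
  rewrite eqEdim; apply/andP; split.
    by apply: direction_min => y z [_ /= ay] [_ /= az];
      rewrite mem_orth dotBr ay az subrr.
  rewrite -ltnS dimF; have := dimvS (subvf (orth a)).
  rewrite dimvf /dim /= mul1n leq_eqVlt => /orP[/eqP dima|//].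
  have /eqP aT : orth a == fullv by rewrite eqEdim subvf dimvf /dim /= mul1n dima.
  have : q - x0 \in orth a by rewrite aT memvf.
  by rewrite mem_orth dotBr ax0 subr_eq0 lt_eqF.
pose k := (b - dot a x) / (b - dot a q).
have k0 : 0 <= k by rewrite divr_ge0 // subr_ge0 // ltW.
have : (x - x0) - k *: (q - x0) \in orth a.
  rewrite mem_orth dotBr dotZr !dotBr ax0 /k; apply/eqP; field.
  by rewrite subr_eq0 gt_eqF.
rewrite -dirE; have /subvP sub : (direction (face Q a b) <= orth a')%VS.
  by apply: direction_min => y z; rewrite FE => -[_ /= ay] [_ /= az];
    rewrite mem_orth dotBr ay az subrr.
move=> /sub; rewrite mem_orth dotBr dotZr !dotBr ax0' subr_eq0 => /eqP xE.
have : k * (dot a' q - b') <= 0 by rewrite mulr_ge0_le0 // subr_le0 Qab'.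
by rewrite -xE; lra.
Qed.

(** A point outside [Q] is beyond some supporting hyperplane, and [facet_above] keeps it beyond
    while the face grows to a facet. That facet belongs to the cover, so one of the inequalities
    fails. *)
Lemma facet_inequalities N (Q : set 'rV[R]_n) (G : 'I_N -> set 'rV[R]_n) :
    (2 < N)%N -> dpolytope n Q -> neighborly_cover Q G ->
  exists (a : 'I_N -> 'rV[R]_n) (b : 'I_N -> R),
    (forall x, Q x <-> forall j, dot (a j) x <= b j) /\
    forall i j, i != j -> exists x, [/\ dot (a i) x = b i, dot (a j) x = b j &
      forall k, k != i -> k != j -> dot (a k) x < b k].
Proof.
move=> N2 polyQ [fG GQ Gcov Gneigh].
have [[V [/finite_seqP[s ->] QE]] /has_dimP[Q0 dimQ]] := polyQ.
have /choice[a /choice[b ab]] j : exists a b, valid Q a b /\ G j = face Q a b.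
  by have [a [b]] := fG j; exists a, b.
have Gmeet i j k : i != j -> exists z, [/\ G i z, G j z & k != i -> k != j -> ~ G k z].
  move=> ij; have pick l : l != i -> l != j -> exists z, [/\ G i z, G j z & ~ G l z].
    move=> li lj; have := Gneigh i j l ij; rewrite ![_ == l]eq_sym => /(_ li lj).
    by move=> /existsNP[z /not_implyP[[iz jz] lz]]; exists z.
  have [/andP[ki kj]|kij] := boolP ((k != i) && (k != j)).
    by have [z [? ? ?]] := pick k ki kj; exists z.
  have [|l] := @ord_notin N [set i; j]%SET; first by rewrite cards2 ij.
  rewrite !inE negb_or => /andP[li lj]; have [z [? ? _]] := pick l li lj.
  by exists z; split=> // ki kj; rewrite ki kj in kij.
have G0 j : G j !=set0.
  have [|i] := @ord_notin N [set j]%SET; first by rewrite cards1 ltnW.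
  by rewrite !inE => ij; have [z [_ ? _]] := Gmeet _ _ i ij; exists z.
have Q_ge x : (forall j, dot (a j) x <= b j) -> Q x.
  move=> xab; apply: contrapT => nQx.
  have [c [d [cd dx]]] : exists c d, valid Q c d /\ d < dot c x.
    rewrite QE in nQx; have [c [d [cd dx]]] := separation nQx.
    by exists c, d; split => //; rewrite QE; apply: valid_hull.
  have [v0 v0s] : exists v, v \in s.
    case: s QE => [QE|v t _]; last by exists v; apply: mem_head.
    (* The hull of the empty set satisfies every inequality, even this one. *)
    have [y] := Q0; rewrite QE => Vy; have : dot 0 y <= -1 :> R.
      by apply: hull_le Vy => z.
    by rewrite dot0l ler0N1.
  have [v vs vmax] := seq_argmax (dot c) v0s.
  have Qv : Q v by rewrite QE; apply: sub_hull.
  have Qcv : valid Q c (dot c v) by rewrite QE; apply: valid_hull.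
  have cvx : dot c v < dot c x by apply: le_lt_trans dx; apply: cd.
  have Fv0 : face Q c (dot c v) !=set0 by exists v.
  have FQ : face Q c (dot c v) <> Q.
    move=> FE; have : (direction Q <= orth c)%VS.
      apply: direction_min => y z; rewrite -FE => -[_ /= cy] [_ /= cz].
      by rewrite mem_orth dotBr cy cz subrr.
    have /eqP -> : direction Q == fullv.
      by rewrite eqEdim subvf dimQ dimvf /dim /= mul1n.
    move=> /subvP/(_ (x - v) (memvf _)).
    by rewrite mem_orth dotBr subr_eq0 gt_eqF.
  rewrite QE in Qcv Fv0 FQ.
  have [a' [b' [Qab' sub F'Q dimF' /(_ cvx) b'x]]] := facet_above x Qcv Fv0 FQ.
  rewrite -QE in Qab' F'Q dimF'; rewrite dimQ in dimF'.
  have fF' : is_face Q (face Q a' b') by exists a', b'.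
  have [j F'j] := Gcov _ fF' F'Q.
  have F'0 : face Q a' b' !=set0.
    by have [y /sub] := Fv0; exists y; rewrite QE.
  have F'E : face Q a' b' = G j.
    apply: (face_eq_of_dim fF' F'0 F'j (is_face_sub (fG j))).
    have := proper_face_dim (fG j) (G0 j) (@GQ j).
    by rewrite dimQ -[X in (_ < X)%N]dimF' ltnS.
  have [Qab GE] := ab j.
  move: b'x; apply/negP; rewrite -leNgt.
  by apply: (facet_functional_sign polyQ Qab Qab') (xab j); rewrite -GE // -F'E.
exists a, b; split=> [x|i j ij].
  by split=> [Qx j|]; [have [+ _] := ab j; apply|exact: Q_ge].
have /choice[z zP] k := Gmeet i j k ij.
have N0 : 0 < N%:R :> R by rewrite ltr0n; lia.
(* All [z k] lie on [G i] and [G j], and for every other [k] the point [z k] is off [G k]; the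
   average is therefore off all the others. *)
pose x := N%:R^-1 *: \sum_k z k.
have dotx c : dot c x = N%:R^-1 * \sum_k dot c (z k).
  by rewrite dotZr; congr (_ * _); apply: (linear_sum (dot_fun c)).
have GP k y : G k y -> Q y /\ dot (a k) y = b k by have [_ ->] := ab k; case.
have avg c : N%:R^-1 * \sum_(k < N) c = c :> R.
  by rewrite sumr_const card_ord -[c *+ N]mulr_natl mulKf // gt_eqF.
exists x; split=> [||k ki kj].
- rewrite dotx -[RHS]avg; congr (_ * _); apply: eq_bigr => k _.
  by have [/GP[]] := zP k.
- rewrite dotx -[RHS]avg; congr (_ * _); apply: eq_bigr => k _.
  by have [_ /GP[]] := zP k.
- rewrite dotx -[ltRHS]avg ltr_pM2l ?invr_gt0 //.
  have Qz l : dot (a k) (z l) <= b k.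
    by have [/GP[Qzl _] _ _] := zP l; have [+ _] := ab k; apply.
  rewrite (bigD1 k) //= [ltRHS](bigD1 k) //= ltr_leD //; last exact: ler_sum.
  have [/GP[Qzk _] _ /(_ ki kj) nGk] := zP k.
  rewrite lt_neqAle Qz andbT; apply/eqP => zE; apply: nGk.
  by have [_ ->] := ab k.
Qed.

End HRepresentation.

(** * Inscribed polytopes in R^4 *)

Section Homogenization.
Variables (R : realType).

Definition hom (t : R) (x : 'rV[R]_4) : 'rV[R]_5 := row_mx (t%:M : 'M_1) x.
Definition weight (v : 'rV[R]_5) : R := lsubmx (v : 'rV_(1 + 4)) 0 0.
Definition affine_part (v : 'rV[R]_5) : 'rV[R]_4 := rsubmx (v : 'rV_(1 + 4)).

Lemma homK v : hom (weight v) (affine_part v) = v.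
Proof. by rewrite /hom /weight /affine_part -mx11_scalar hsubmxK. Qed.

Lemma weight_hom t x : weight (hom t x) = t.
Proof. by rewrite /weight /hom row_mxKl mxE eqxx mulr1n. Qed.

Lemma affine_part_hom t x : affine_part (hom t x) = x.
Proof. by rewrite /affine_part /hom row_mxKr. Qed.

Lemma weightD u v : weight (u + v) = weight u + weight v.
Proof. by rewrite /weight !mxE. Qed.

Lemma weightZ k v : weight (k *: v) = k * weight v.
Proof. by rewrite /weight !mxE. Qed.

Lemma affine_partD u v : affine_part (u + v) = affine_part u + affine_part v.
Proof. by apply/rowP => i; rewrite !mxE. Qed.

Lemma affine_partZ k v : affine_part (k *: v) = k *: affine_part v.
Proof. by apply/rowP => i; rewrite !mxE. Qed.

Lemma homZ k t x : k *: hom t x = hom (k * t) (k *: x).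
Proof.
apply: (etrans (@scale_row_mx R 1 1 4 k t%:M x)).
by rewrite scale_scalar_mx.
Qed.

Section SphereForm.
Variables (c : 'rV[R]_4) (r : R).

(** The polar form of [|x - t c|^2 - r^2 t^2], the homogenized equation of the sphere. *)
Definition sphere_form (u v : 'rV[R]_5) : R :=
  dot (affine_part u - weight u *: c) (affine_part v - weight v *: c)
  - r ^+ 2 * weight u * weight v.

Lemma sphere_form_sym u v : sphere_form u v = sphere_form v u.
Proof. by rewrite /sphere_form dotC mulrAC. Qed.

Lemma sphere_formD u v w : sphere_form (u + v) w = sphere_form u w + sphere_form v w.
Proof.
rewrite /sphere_form weightD affine_partD scalerDl opprD.
by rewrite [X in dot X _]addrACA [in LHS]dotDl; ring.
Qed.

Lemma sphere_formZ k u w : sphere_form (k *: u) w = k * sphere_form u w.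
Proof.
rewrite /sphere_form weightZ affine_partZ -scalerA -scalerBr dotZl.
by rewrite mulrBr; congr (_ - _); ring.
Qed.

(** For [x = y] this makes points of the sphere null; for distinct points it yields the nonvanishing
    of [B a1 a2] in [wedge_not_inscribed]. *)
Lemma sphere_form_hom x y : sphere c r x -> sphere c r y ->
  sphere_form (hom 1 x) (hom 1 y) = - (dot (x - y) (x - y) / 2).
Proof.
rewrite /sphere /= => xr yr; rewrite /sphere_form !weight_hom !affine_part_hom.
rewrite !scale1r !mulr1.
have -> : x - y = (x - c) - (y - c) by rewrite opprB addrA subrK.
move: xr yr; move: (x - c) (y - c) => u w ur wr.
by rewrite dotBl !dotBr ur wr (dotC w); lra.
Qed.

End SphereForm.

Variables (Q : set 'rV[R]_4) (a : 'I_8 -> 'rV[R]_4) (b : 'I_8 -> R).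
Hypothesis polyQ : dpolytope 4 Q.
Hypothesis Qab : forall x, Q x <-> forall j, dot (a j) x <= b j.
Hypothesis Q_pair : forall i j, i != j ->
  exists x, [/\ dot (a i) x = b i, dot (a j) x = b j &
    forall k, k != i -> k != j -> dot (a k) x < b k].

Definition facet_matrix : 'M[R]_(5, 8) :=
  col_mx (\row_j b j) (\matrix_(i, j) - a j 0 i) : 'M_(1 + 4, 8).
Local Notation N := facet_matrix.

Lemma slack_hom t x j : slack N (hom t x) j = t * b j - dot (a j) x.
Proof.
rewrite /slack (_ : hom t x *m N = t%:M *m \row_j b j + x *m \matrix_(i, j) - a j 0 i).
  rewrite mul_scalar_mx !mxE; congr (_ + _).
  by rewrite -sumrN; apply: eq_bigr => i _; rewrite !mxE; ring.
exact: (@mul_row_col R 1 1 4 8 t%:M x).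
Qed.

Lemma slack_pair i j : i != j ->
  exists v, [/\ slack N v i = 0, slack N v j = 0 &
    forall k, k != i -> k != j -> 0 < slack N v k].
Proof.
move=> /Q_pair[x [xi xj xk]]; exists (hom 1 x); rewrite !slack_hom !mul1r xi xj !subrr.
by split=> // k ki kj; rewrite slack_hom mul1r subr_gt0 xk.
Qed.

(** No facet contains both a point interior to the ridge of 0, 1 and one interior to the ridge of 2,
    3, so their sum is off every facet. It has weight 2 as a sum of two points of weight 1. *)
Lemma slack_interior : exists2 y, weight y = 2 & forall j, 0 < slack N y j.
Proof.
have [x1 [x11 x12 x1P]] := Q_pair (isT : (0 : 'I_8) != 1).
have [x2 [x21 x22 x2P]] := Q_pair (isT : (2%:R : 'I_8) != 3%:R).
have Q1 j : dot (a j) x1 <= b j.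
  have [->|j0] := eqVneq j 0; first by rewrite x11.
  by have [->|j1] := eqVneq j 1; [rewrite x12|rewrite ltW ?x1P].
have Q2 j : dot (a j) x2 <= b j.
  have [->|j0] := eqVneq j 2%:R; first by rewrite x21.
  by have [->|j1] := eqVneq j 3%:R; [rewrite x22|rewrite ltW ?x2P].
exists (hom 1 x1 + hom 1 x2) => [|j]; first by rewrite weightD !weight_hom; ring.
rewrite slackD !slack_hom !mul1r.
have [j01|] := boolP ((j == 0) || (j == 1)).
  rewrite ltr_wpDl ?subr_ge0 // subr_gt0; apply: x2P.
    by case/orP: j01 => /eqP->.
  by case/orP: j01 => /eqP->.
by rewrite negb_or => /andP[j0 j1]; rewrite ltr_pwDl ?subr_ge0 ?subr_gt0 ?x1P.
Qed.

(* A nonzero vector with nonnegative slacks and weight at most 0 would yield,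
   after adding a multiple of an interior point, an unbounded direction of [Q]. *)
Lemma weight_gt0 v : v != 0 -> (forall j, 0 <= slack N v j) -> 0 < weight v.
Proof.
move=> v0 vge; rewrite ltNge; apply/negP => t0.
have [y y2 ypos] := slack_interior.
(* As [y] has weight 2, [u] has weight 0; its slacks are nonnegative because [weight v <= 0]. *)
pose u := 2 *: v - weight v *: y.
have u_weight : weight u = 0.
  by rewrite /u -scaleNr weightD !weightZ y2; ring.
have u_ge0 j : 0 <= slack N u j.
  rewrite /u slackB !slackZ subr_ge0 (@le_trans _ _ 0) ?mulr_ge0 //.
  by rewrite mulr_le0_ge0 // ltW.
have uE : u = hom 0 (affine_part u) by rewrite -{1}[u]homK u_weight.
set d := affine_part u in uE.
have ad j : dot (a j) d <= 0.
  by have := u_ge0 j; rewrite uE slack_hom mul0r sub0r oppr_ge0.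
have d0 : d != 0.
  apply/eqP => d0; have u0 : u = 0.
    rewrite uE d0; apply/rowP => i; rewrite mxE.
    by case: splitP => k _; rewrite !mxE ?mul0rn.
  have [tE|tN0] := eqVneq (weight v) 0.
    move: u0; rewrite /u tE scale0r subr0 => /eqP.
    by rewrite scaler_eq0 (negPf v0) pnatr_eq0.
  have : slack N u 0 = 0 by rewrite u0 -[0 in LHS](subrr v) slackB subrr.
  have t_lt0 : weight v < 0 by rewrite lt_neqAle tN0.
  have ty : weight v * slack N y 0 < 0 by rewrite nmulr_rlt0.
  by rewrite /u slackB !slackZ; have := vge 0; lra.
have [[V [/finite_seqP[s ->] QE]] /has_dimP[[q Qq] _]] := polyQ.
have [v1 v1s] : exists v, v \in s.
  case: s QE => [QE|x s' _]; last by exists x; apply: mem_head.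
  move: Qq; rewrite QE => Vq; have : dot 0 q <= -1 :> R by apply: hull_le Vq.
  by rewrite dot0l ler0N1.
have [m ms mmax] := seq_argmax (dot d) v1s.
have Qd x : Q x -> dot d x <= dot d m.
  by rewrite QE => Qx; apply: hull_le Qx => x' /mmax.
have dd : 0 < dot d d by rewrite lt_def dotvv_eq0 d0 dotvv_ge0.
(* This step from [q] along [d] takes [dot d] to 1 above its maximum on [Q]. *)
pose k := (dot d m - dot d q + 1) / dot d d.
have k0 : 0 <= k by rewrite divr_ge0 ?dotvv_ge0 // addr_ge0 // subr_ge0 Qd.
have : dot d (q + k *: d) <= dot d m.
  apply/Qd/Qab => j; rewrite dotDr dotZr; have := (Qab q).1 Qq j.
  by have := mulr_ge0_le0 k0 (ad j); lra.
by rewrite dotDr dotZr divfK ?gt_eqF //; lra.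
Qed.

Lemma slack_inj : row_free N.
Proof.
apply: inj_row_free => v vN; apply/eqP; apply: contraT => v0.
have sl j : slack N v j = 0 by rewrite /slack vN mxE.
have vp : 0 < weight v by apply: weight_gt0 => // j; rewrite sl.
have : 0 < weight (- v).
  apply: weight_gt0; first by rewrite oppr_eq0.
  by move=> j; rewrite -scaleN1r slackZ sl mulr0.
by rewrite -scaleN1r weightZ mulN1r oppr_gt0 ltNge ltW.
Qed.

Section Vertices.
Variables (p : nat -> 'I_8) (c : 'rV[R]_4) (r : R).
Hypothesis p_inj : {in [pred i | (i < 8)%N] &, injective p}.
Hypothesis Q_sphere : vertices Q `<=` sphere c r.

(** The sum of the four inequalities indexed by [z] supports [Q], with equality only where all four
    slacks vanish. By [proportional] these zeros form a line through the origin of [R^5], with one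
    point of weight 1. *)
Lemma supported_vertex (z l : seq nat) v :
    size z == 4 -> size l == 4 -> perm_eq (z ++ l) (iota 0 8) ->
    supported_on N p v l ->
  exists t x, [/\ 0 < t, v = t *: hom 1 x & sphere c r x].
Proof.
move=> z4 l4 zl [vl vz].
have zl_lt i : i \in z ++ l -> (i < 8)%N by rewrite (perm_mem zl) mem_iota.
have : uniq (z ++ l) by rewrite (perm_uniq zl) iota_uniq.
rewrite cat_uniq => /and3P[uz /hasPn zNl ul].
have {}vz i : i \in z -> slack N v (p i) = 0.
  move=> iz; apply: vz; first by rewrite zl_lt // mem_cat iz.
  by apply: contraL iz => /zNl.
have [j jl] : exists j, j \in l.
  by case: l l4 {zl vl zl_lt zNl ul} => // j l _; exists j; apply: mem_head.
have j8 : (j < 8)%N by rewrite zl_lt // mem_cat jl orbT.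
have v0 : v != 0.
  by apply: contraTneq (vl j jl) => ->; rewrite -(subrr v) slackB subrr ltxx.
have p_surj k : exists2 i, i \in z ++ l & k = p i.
  have : k \in map p (iota 0 8).
    have u8 : uniq (map p (iota 0 8)).
      rewrite map_inj_in_uniq ?iota_uniq // => m n.
      by rewrite !mem_iota => m8 n8; apply: p_inj.
    have [||_ ->] := @uniq_min_size _ _ (enum 'I_8) u8.
    - by move=> i _; rewrite mem_enum.
    - by rewrite size_enum_ord size_map size_iota.
    - by rewrite mem_enum.
  by move=> /mapP[i i8 ->]; exists i; rewrite // (perm_mem zl).
have v_ge0 k : 0 <= slack N v k.
  have [i + ->] := p_surj k; rewrite mem_cat => /orP[/vz-> //|/vl]; exact: ltW.
have t0 := weight_gt0 v0 v_ge0.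
pose x := (weight v)^-1 *: affine_part v.
have vE : v = weight v *: hom 1 x.
  by rewrite -{1}[v]homK homZ mulr1 /x scalerA divff ?scale1r // gt_eqF.
exists (weight v), x; split => //; apply: Q_sphere.
have slx k : slack N (hom 1 x) k = (weight v)^-1 * slack N v k.
  by rewrite {2}vE slackZ mulKf // gt_eqF.
have Qx : Q x.
  apply/Qab => k; have : 0 <= slack N (hom 1 x) k.
    by rewrite slx mulr_ge0 // invr_ge0 ltW.
  by rewrite slack_hom mul1r subr_ge0.
exists (\sum_(i <- z) a (p i)), (\sum_(i <- z) b (p i)).
have dotE y : dot (\sum_(i <- z) a (p i)) y = \sum_(i <- z) dot (a (p i)) y.
  rewrite dotC -[LHS]/(dot_fun y _) linear_sum; apply: eq_bigr => i _; exact: dotC.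
split=> [y /Qab Qy|]; first by rewrite dotE ler_sum.
apply/seteqP; split=> [_ ->|y [/= Qy]].
  split=> //=; rewrite dotE; apply: eq_big_seq => i /vz vi.
  have := slx (p i); rewrite vi mulr0 slack_hom mul1r => /eqP.
  by rewrite subr_eq0 => /eqP.
rewrite dotE => sumE.
have yz i : i \in z -> slack N (hom 1 y) (p i) = 0.
  have : \sum_(i <- z) (b (p i) - dot (a (p i)) y) == 0.
    by rewrite sumrB sumE subrr.
  rewrite psumr_eq0 => [/allP yz /yz /eqP|k _]; first by rewrite slack_hom mul1r.
  by rewrite subr_ge0; have /Qab := Qy.
have E : hom 1 y = (slack N (hom 1 y) (p j) / slack N (hom 1 x) (p j)) *: hom 1 x.
  apply: (proportional slack_pair p_inj z4).
  - by rewrite /= uz andbT; exact: zNl.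
  - by rewrite /= j8 /=; apply/allP => i iz; rewrite zl_lt // mem_cat iz.
  - by apply/allP => i iz; rewrite yz // slx vz // mulr0 eqxx.
  - by rewrite slx mulf_neq0 ?invr_eq0 ?gt_eqF ?vl.
set k := _ / _ in E.
have k1 : k = 1 by have := congr1 weight E; rewrite weightZ !weight_hom mulr1.
by have := congr1 affine_part E; rewrite k1 scale1r !affine_part_hom.
Qed.

End Vertices.

Lemma neighborly_inequalities_not_inscribed c r :
  ~ vertices Q `<=` sphere c r.
Proof.
move=> Q_sphere.
have [G [G_free GN G_total]] := gale_dual_exists slack_inj.
have bal := chi_balanced slack_pair G_free GN.
have [F [A [B [c1 [c2 [c3 [c4 [c5 [uniq8 wedge]]]]]]]]] :=
  balanced_wedge (card_ord 8) bal.
pose p i := nth F [:: F; A; B; c1; c2; c3; c4; c5] i.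
have p_inj : {in [pred i | (i < 8)%N] &, injective p}.
  by move=> i j i8 j8 /eqP; rewrite nth_uniq // => /eqP.
have point (h i j k : nat) : uniq [:: h; i; j; k] ->
    all (fun i => i < 8)%N [:: h; i; j; k] ->
    pos_dependent (chi G) (p h) (p i) (p j) (p k) ->
    exists v, supported_on N p v [:: h; i; j; k] /\ slack N v (p h) = 1.
  move=> u l8 pd.
  have pu : uniq [:: p h; p i; p j; p k].
    rewrite -[X in uniq X]/(map p [:: h; i; j; k]) map_inj_in_uniq // => m n.
    by move=> /(allP l8) m8 /(allP l8) n8; apply: p_inj.
  have [v [vpos vz]] := positive_relation_point slack_pair G_free GN G_total pu pd.
  have vh : 0 < slack N v (p h) by apply: vpos; rewrite inE eqxx.
  exists ((slack N v (p h))^-1 *: v); split; last by rewrite slackZ mulVf ?gt_eqF.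
  split=> [m ml|m m8 ml]; rewrite slackZ.
    rewrite pmulr_rgt0 ?invr_gt0 //; apply: vpos.
    exact: (map_f p ml).
  rewrite (vz (p m)) ?mulr0 //; apply: contra ml.
  rewrite -[X in _ \in X]/(map p [:: h; i; j; k]) => /mapP[m' m'l pm].
  by rewrite (p_inj _ _ m8 (allP l8 _ m'l) pm).
(* A positive relation containing B is the slack vector of a vertex off B and on A. Hence the
   relations with B give the [a]'s and those with A the [b]'s. *)
have [wA1 wA2 wA3 wA4 /and4P[wB1 wB2 wB3 wB4]] := and5P wedge.
have [a1 [a1P a1_1]] := point 2 5 6 7 isT isT wB1.
have [a2 [a2P a2_1]] := point 2 3 6 7 isT isT wB2.
have [a3 [a3P a3_1]] := point 2 3 4 7 isT isT wB3.
have [a4 [a4P a4_1]] := point 2 3 4 5 isT isT wB4.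
have [b1 [b1P b1_1]] := point 1 5 6 7 isT isT wA1.
have [b2 [b2P b2_1]] := point 1 3 6 7 isT isT wA2.
have [b3 [b3P b3_1]] := point 1 3 4 7 isT isT wA3.
have [b4 [b4P b4_1]] := point 1 3 4 5 isT isT wA4.
have vertex z l v := @supported_vertex p c r p_inj Q_sphere z l v.
have null z l v : size z == 4 -> size l == 4 -> perm_eq (z ++ l) (iota 0 8) ->
    supported_on N p v l -> sphere_form c r v v = 0.
  move=> z4 l4 zl vl; have [t [x [_ -> xr]]] := vertex z l v z4 l4 zl vl.
  rewrite sphere_formZ sphere_form_sym sphere_formZ sphere_form_hom //.
  by rewrite subrr dot0l mul0r oppr0 !mulr0.
apply: (wedge_not_inscribed slack_pair p_inj (sphere_form_sym c r)
  (sphere_formD c r) (sphere_formZ c r) a1P a2P a3P a4P b1P b2P b3P b4P).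
- by move=> v; rewrite !inE => /or4P[]/eqP->.
- by move=> v; rewrite !inE => /or4P[]/eqP->.
- move=> v; rewrite !inE.
  move=> /or4P[/eqP->|/eqP->|/eqP->|/or4P[/eqP->|/eqP->|/eqP->|/orP[]/eqP->]].
  + by apply: (null [:: 0; 1; 3; 4]) a1P.
  + by apply: (null [:: 0; 1; 4; 5]) a2P.
  + by apply: (null [:: 0; 1; 5; 6]) a3P.
  + by apply: (null [:: 0; 1; 6; 7]) a4P.
  + by apply: (null [:: 0; 2; 3; 4]) b1P.
  + by apply: (null [:: 0; 2; 4; 5]) b2P.
  + by apply: (null [:: 0; 2; 5; 6]) b3P.
  + by apply: (null [:: 0; 2; 6; 7]) b4P.
have [t1 [x1 [t1_gt0 a1E x1r]]] :=
  vertex [:: 0; 1; 3; 4] [:: 2; 5; 6; 7] a1 isT isT isT a1P.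
have [t2 [x2 [t2_gt0 a2E x2r]]] :=
  vertex [:: 0; 1; 4; 5] [:: 2; 3; 6; 7] a2 isT isT isT a2P.
rewrite a1E a2E sphere_formZ sphere_form_sym sphere_formZ sphere_form_hom //.
do 2![apply: mulf_neq0; first by rewrite gt_eqF].
rewrite oppr_eq0; apply: mulf_neq0; last by rewrite invr_eq0 pnatr_eq0.
(* The points differ since facet [c3] contains the second but not the first. *)
rewrite dotvv_eq0 subr_eq0; apply/eqP => x21.
have : 0 < slack N a1 (p 5) by apply: a1P.1; rewrite !inE eqxx orbT.
have : slack N a2 (p 5) = 0 by apply: a2P.2.
rewrite a1E a2E x21 !slackZ => /eqP; rewrite mulf_eq0 gt_eqF //= => /eqP->.
by rewrite mulr0 ltxx.
Qed.

End Homogenization.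

Lemma inscribed_not_neighborly (R : realType) (Q : set 'rV[R]_4)
    (G : 'I_8 -> set 'rV[R]_4) :
  inscribed Q -> neighborly_cover Q G -> False.
Proof.
move=> [polyQ [c [r [_ Qs]]]] covQ.
have [a [b [Qab Qpair]]] := facet_inequalities (isT : (2 < 8)%N) polyQ covQ.
exact: neighborly_inequalities_not_inscribed polyQ Qab Qpair _ _ Qs.
Qed.

Local Close Scope classical_set_scope.
Local Close Scope ring_scope.

Theorem corollary1p4 (R : realType) :
  ~ fvector_inscribable R [:: 20; 40; 28; 8].
Proof.
move=> [n [P [polyP fP [Q [inscQ PQ]]]]].
have [F covF] := neighborly_facets polyP (fP 2 isT) (fP 3 isT).
have [G covG] := neighborly_cover_comb_equiv PQ covF.
exact: inscribed_not_neighborly inscQ covG.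
Qed.
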